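(* Assume (Amax), (Amin) and (Aint). For each $n$ let $\hat\theta_n$ be a maximizer over $\Theta$ of $\theta\mapsto\frac1n\ell_n(\theta)$. Then there exists $M>0$ such that $\mathbb P^*$-almost surely there exists $n_{\mathrm{loc}}\in\mathbb N$ with $\hat\theta_n\in\Theta^{OK}_n(M)$ for all $n\ge n_{\mathrm{loc}}$.
   Context: Setting. Fix integers $K\ge1$, $d\ge1$ and $\sigma_-\in(0,1)$. For $K'\in\mathbb N^*$, $[K']=\{1,\dots,K'\}$, $\Delta_{K'}$ is the set of probability vectors on $[K']$ and $\Sigma^{\sigma_-}_{K'}$ is the set of $K'\times K'$ stochastic matrices all of whose entries are $\ge\sigma_-$. $\mathbb R_d[X]$ is the set of real polynomials of degree at most $d$, viewed as functions on $\mathbb R_+$. $\Gamma$ is a set of probability densities on $\mathbb R$ (w.r.t. Lebesgue measure), endowed with the topology of pointwise convergence and assumed compact. The model is $\Theta=\bigcup_{K'=1}^K\{[K']\}\times\Delta_{K'}\times\Sigma^{\sigma_-}_{K'}\times\Gamma^{K'}\times(\mathbb R_d[X])^{K'}$, with elements $\theta=(K^\theta,\pi^\theta,Q^\theta,\gamma^\theta,T^\theta)$. Under $\theta$, $(X_t)_{t\ge1}$ is a Markov chain on $[K^\theta]$ with initial law $\pi^\theta$ and transition matrix $Q^\theta$, and conditionally on $(X_t)_t$ the $Y_t$ are independent, $Y_t$ having density $y\mapsto\gamma^\theta_{X_t}(y-T^\theta_{X_t}(t))$; $\ell_n(\theta)=\log\sum_{x_1^n\in[K^\theta]^n}\pi^\theta(x_1)\prod_{t=2}^nQ^\theta(x_{t-1},x_t)\prod_{t=1}^n\gamma^\theta_{x_t}(Y_t-T^\theta_{x_t}(t))$.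 True parameter: $\theta^*=(K^*,\pi^*,Q^*,\gamma^*,T^* )\in\Theta$. Data: under $\mathbb P^*$ (expectation $\mathbb E^*$), $(X_t)_{t\ge1}$ is a Markov chain on $[K^*]$ with $(\pi^*,Q^* )$; for each $x\in[K^*]$, $(Z^x_t)_{t\ge1}$ is i.i.d. with density $\gamma^*_x$, these sequences being mutually independent and independent of $(X_t)$; $Z_t=Z^{X_t}_t$, $Z^{\max}_t=\max_x|Z^x_t|$, $Y_t=Z_t+T^*_{X_t}(t)$. Assumptions. (Amax): there is a nonincreasing $g:\mathbb R_+\to\mathbb R_+$ with $g(z)\to0$ as $z\to\infty$ and $\gamma(z)\le g(|z|)$ for all $\gamma\in\Gamma$, $z$. (Amin): there is a nonincreasing $m:\mathbb R_+\to\mathbb R_+$ with $\gamma(z)\ge m(|z|)>0$ for all $\gamma\in\Gamma$, $z$. (Aint): for every $M>0$, $\mathbb E^*|\log m(M+Z^{\max}_1)|<\infty$. With $\|f\|_{\infty,[0,n]}=\sup_{t\in[0,n]}|f(t)|$, $\Theta^{OK}_n(M)$ is the set of $\theta\in\Theta$ such that every $x^*\in[K^*]$ has some $x\in[K^\theta]$ with $\|T^*_{x^*}-T^\theta_x\|_{\infty,[0,n]}\le M$, and every $x\in[K^\theta]$ has some $x^*\in[K^*]$ with $\|T^*_{x^*}-T^\theta_x\|_{\infty,[0,n]}\le M$. *)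

(* Defs.v *)
From HB Require Import structures.
From mathcomp Require Import all_boot all_order all_algebra.
From mathcomp Require Import all_classical all_reals all_analysis.
Set Implicit Arguments. Unset Strict Implicit. Unset Printing Implicit Defensive.
Import Order.TTheory GRing.Theory Num.Theory.
Import numFieldNormedType.Exports.
Local Open Scope classical_set_scope.
Local Open Scope ring_scope.

Section Defs.
Variable R : realType.

Definition is_density (f : R -> R) : Prop :=
  measurable_fun setT f /\ (forall z, 0 <= f z) /\
  (\int[@lebesgue_measure R]_(z in setT) (f z)%:E = 1)%E.

(* A candidate parameter theta = (K^theta, pi, Q, gamma, T); hidden states are 'I_K. *)
Record param := Param {
  pK : nat;
  ppi : 'I_pK -> R;
  pQ : 'I_pK -> 'I_pK -> R;
  pgam : 'I_pK -> R -> R;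
  pT : 'I_pK -> {poly R} }.
Arguments ppi : clear implicits.
Arguments pQ : clear implicits.
Arguments pgam : clear implicits.
Arguments pT : clear implicits.

Definition prob_vector k (p : 'I_k -> R) : Prop :=
  (forall i, 0 <= p i) /\ \sum_(i < k) p i = 1.

Definition stoch_lb k (sigm : R) (Q : 'I_k -> 'I_k -> R) : Prop :=
  (forall i j, sigm <= Q i j) /\ (forall i, \sum_(j < k) Q i j = 1).

Definition in_Theta (K d : nat) (sigm : R) (Gam : set (R -> R)) (th : param) : Prop :=
  [/\ (1 <= pK th <= K)%N,
      prob_vector (ppi th),
      stoch_lb sigm (pQ th),
      (forall x, Gam (pgam th x)) &
      (forall x, (size (pT th x) <= d.+1)%N) ].

(* log-likelihood ell_n(theta) of the observations Y_1..Y_n (Y indexed by nat, time t >= 1).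
   Index i : 'I_n.+1 stands for time i+1. ell_0 := 0 (= log 1, unused). *)
Definition loglik (th : param) (Y : nat -> R) (n : nat) : R :=
  match n with
  | 0 => 0
  | m.+1 =>
    ln (\sum_(x : {ffun 'I_m.+1 -> 'I_(pK th)})
          (ppi th (x ord0)
           * \prod_(i < m) pQ th (x (widen_ord (leqnSn m) i)) (x (lift ord0 i))
           * \prod_(i < m.+1) pgam th (x i) (Y i.+1 - (pT th (x i)).[i.+1%:R])))
  end.

Definition sup_close (n : nat) (M : R) (p q : {poly R}) : Prop :=
  forall s : R, 0 <= s <= n%:R -> `|p.[s] - q.[s]| <= M.

(* Theta^OK_n(M) (membership in Theta is required separately). *)
Definition Theta_OK (ts : param) (n : nat) (M : R) (th : param) : Prop :=
  (forall xs : 'I_(pK ts), exists x : 'I_(pK th), sup_close n M (pT ts xs) (pT th x)) /\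
  (forall x : 'I_(pK th), exists xs : 'I_(pK ts), sup_close n M (pT ts xs) (pT th x)).

Definition nonincr_pos (g : R -> R) : Prop :=
  (forall a b, 0 <= a -> a <= b -> g b <= g a) /\ (forall a, 0 <= a -> 0 <= g a).

Definition Amax (Gam : set (R -> R)) : Prop :=
  exists g : R -> R, nonincr_pos g /\ (g z @[z --> +oo]) --> (0 : R) /\
    (forall gam, Gam gam -> forall z, gam z <= g `|z|).

Definition Amin (Gam : set (R -> R)) (m : R -> R) : Prop :=
  nonincr_pos m /\ (forall gam, Gam gam -> forall z, m `|z| <= gam z /\ 0 < m `|z|).

(* Data-generating model under P^*: (X_t)_{t>=1} Markov chain with initial law pi^* and transition Q^*, (Z^x_t) independent
   with densities gamma^*_x, independent of X.  Stated through the joint finite-dimensional law: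
   for every n, path x_1..x_{n} and Borel sets B_{k,t},
   P(X_t = x_t, Z^k_t in B_{k,t} for all t <= n, k) =
     pi^*(x_1) prod Q^*(x_{t-1},x_t) * prod_{k,t} int_{B_{k,t}} gamma^*_k . *)
Definition data_model (d0 : measure_display) (Omega : measurableType d0)
  (P : probability Omega R) (ts : param)
  (X : nat -> Omega -> 'I_(pK ts)) (Z : 'I_(pK ts) -> nat -> Omega -> R) : Prop :=
  (forall t x, measurable (X t @^-1` [set x])) /\
  (forall k t, measurable_fun setT (Z k t)) /\
  forall (n : nat) (x : {ffun 'I_n.+1 -> 'I_(pK ts)}) (B : 'I_(pK ts) -> 'I_n.+1 -> set R),
    (forall k t, measurable (B k t)) ->
    P [set w | forall t : 'I_n.+1, X t.+1 w = x t /\ forall k, B k t (Z k t.+1 w)] =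
    ((ppi ts (x ord0) *
      \prod_(i < n) pQ ts (x (widen_ord (leqnSn n) i)) (x (lift ord0 i)))%:E *
     \prod_(k < pK ts) \prod_(t < n.+1)
        \int[@lebesgue_measure R]_(z in B k t) (pgam ts k z)%:E)%E.

Definition Zmax (d0 : measure_display) (Omega : measurableType d0) k
  (Z : 'I_k -> nat -> Omega -> R) (t : nat) (w : Omega) : R :=
  \big[Num.max/0]_(x < k) `|Z x t w|.

Definition obs (d0 : measure_display) (Omega : measurableType d0) (ts : param)
  (X : nat -> Omega -> 'I_(pK ts)) (Z : 'I_(pK ts) -> nat -> Omega -> R)
  (w : Omega) (t : nat) : R :=
  Z (X t w) t w + (pT ts (X t w)).[t%:R].

End Defs.

(* Main.v *)
(** The compared parameter is first the truth, then the maximizer with one state removed.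

    If some true trend [T*_x*] is far from all fitted trends on [0, n], then, a polynomial of
    degree at most [d] being small only on a small fraction of [1, n], most visits of the chain
    to [x*] produce observations whose fitted densities are all tiny; there are at least [c n]
    visits, so the log-likelihood falls below that of the truth, which is at least [- C n].

    If a fitted trend [T_x] is far from all true ones, its state [x] is useless: deleting [x] and
    renormalising multiplies the weight of every remaining transition by at least
    [1 / (1 - sigma)], while the paths visiting [x] at time [t] are charged to the state close to
    the true trend at time [t], at the price of a factor [1 + A g / m (M + Zmax_t)], whose average
    logarithm can be made small.  The smaller model, which is still in Theta, would thus be
    strictly more likely.

    Both steps need an almost sure upper bound, up to a factor 2, for empirical averages of
    [f (Zmax_t)]: truncation, Chebyshev and Borel-Cantelli along the times [2 ^ k]. *)

Require Import Defs.
From HB Require Import structures.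
From mathcomp Require Import all_boot all_order all_algebra.
From mathcomp Require Import all_classical all_reals all_analysis.
From mathcomp Require Import measurable_realfun ring lra.
Set Implicit Arguments.
Unset Strict Implicit.
Unset Printing Implicit Defensive.
Import Order.TTheory GRing.Theory Num.Theory.
Import numFieldNormedType.Exports.
Local Open Scope classical_set_scope.
Local Open Scope ring_scope.

(** * Polynomials small on many integers *)

(** Induction on the degree, in the manner of Newton interpolation: [p - p.[t 0]] is divisible by
    [X - t 0], and the quotient has smaller degree and is controlled at the remaining nodes. *)
Lemma poly_bound_separated (R : realFieldType) (d : nat) (p : {poly R})
    (t : nat -> R) (D b r s : R) :
  (size p <= d.+1)%N -> 0 <= D -> 0 <= b -> 0 < s -> b <= r * s ->
  (forall i, (i <= d)%N -> 0 <= t i <= b) ->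
  (forall i j, (i < j <= d)%N -> s <= t j - t i) ->
  (forall i, (i <= d)%N -> `|p.[t i]| <= D) ->
  forall x, 0 <= x <= b -> `|p.[x]| <= D * (1 + 2 * r) ^+ d.
Proof.
elim: d => [|d IH] in p t D * => sp D0 b0 s0 brs tb ts pD x xb.
  by move: pD => /(_ 0 isT); rewrite (size1_polyC sp) !hornerC expr0 mulr1.
have r0 : 0 <= r by rewrite -(pmulr_lge0 r s0); exact: le_trans brs.
have /factor_theorem [q pq] : root (p - (p.[t 0%N])%:P) (t 0%N).
  by rewrite /root !hornerE subrr.
have pE y : p.[y] = p.[t 0%N] + q.[y] * (y - t 0%N).
  by have := congr1 (horner^~ y) pq; rewrite !hornerE => <-; rewrite addrC subrK.
have sq : (size q <= d.+1)%N.
  case: (eqVneq q 0) => [->|q0]; first by rewrite size_poly0.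
  have : (size (p - (p.[t 0%N])%:P)%R <= d.+2)%N.
    rewrite (leq_trans (size_polyD _ _)) // geq_max sp size_polyN.
    by rewrite (leq_trans (size_polyC_leq1 _)).
  by rewrite pq size_Mmonic ?monicXsubC // size_XsubC addn2.
(* At [t i.+1] the quotient is a difference of two values of [p], at most [2 * D], divided by a gap
   of at least [s]. *)
have qb : `|q.[x]| <= (2 * D / s) * (1 + 2 * r) ^+ d.
  apply: (IH q (fun i => t i.+1)) => //.
  - by rewrite divr_ge0 ?mulr_ge0 // ltW.
  - by move=> i id; apply: tb.
  - by move=> i j ij; apply: ts.
  move=> i id; rewrite ler_pdivlMr //.
  have h : s <= `|t i.+1 - t 0%N| by rewrite (le_trans (ts 0%N i.+1 _)) // ler_norm.
  apply: le_trans (_ : `|q.[t i.+1]| * `|t i.+1 - t 0%N| <= _).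
    by rewrite ler_wpM2l.
  rewrite -normrM.
  have -> : q.[t i.+1] * (t i.+1 - t 0%N) = - p.[t 0%N] + p.[t i.+1].
    by rewrite (pE (t i.+1)) addKr.
  by rewrite (le_trans (ler_normD _ _)) // normrN mulr2n mulrDl mul1r lerD // pD.
rewrite pE (le_trans (ler_normD _ _)) // normrM.
have h : `|x - t 0%N| <= b.
  by have := tb 0 isT; rewrite ler_norml; lra.
set e := (1 + 2 * r) ^+ d in qb *.
have e1 : 1 <= e by rewrite exprn_ege1 // lerDl mulr_ge0.
apply: le_trans (_ : D + (2 * D / s * e) * b <= _).
  by rewrite lerD ?pD // ler_pM.
(* Replacing [b] by [r * s] cancels the division by [s]: only the ratio [r] of length to separation
   survives. *)
apply: le_trans (_ : D + (2 * D / s * e) * (r * s) <= _).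
  have h0 : 0 <= 2 * D / s * e by apply: le_trans qb; exact: normr_ge0.
  by rewrite lerD2l ler_wpM2l.
have -> : 2 * D / s * e * (r * s) = 2 * D * e * r by field; rewrite gt_eqF.
rewrite exprS -/e; nra.
Qed.

(** A set of more than [dl * n] integers in [[1, n]] contains [d.+1] points separated by a fixed
    fraction of [n]. Were [p] small on it, interpolation would make [p] bounded on all of [[0, n]],
    with a constant that does not depend on [n]. *)
Lemma count_poly_small (R : realType) (d n : nat) (p : {poly R}) (D dl : R) :
  (size p <= d.+1)%N -> 0 <= D -> 0 < dl -> d.+1%:R <= dl * n%:R ->
  (exists2 x, 0 <= x <= n%:R &
     D * (1 + 2 * (2 * d.+1%:R / dl)) ^+ d < `|p.[x]|) ->
  \sum_(i < n) ((`|p.[i.+1%:R]| <= D)%R)%:R <= dl * n%:R :> R.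
Proof.
move=> sp D0 dl0 dn [x xn px]; rewrite leNgt; apply/negP => cn.
pose E := [seq i <- iota 1 n | `|p.[i%:R]| <= D].
have sE : \sum_(i < n) ((`|p.[i.+1%:R]| <= D)%R)%:R = (size E)%:R :> R.
  rewrite size_filter -sum1_count natr_sum [RHS]big_mkcond /=.
  rewrite -[X in iota X](addn0 1%N) iotaDl big_map.
  rewrite (_ : iota 0 n = index_iota 0 n) ?big_mkord; last by rewrite /index_iota subn0.
  by apply: eq_bigr => i _; rewrite add1n; case: ifP.
rewrite sE in cn.
pose q := (size E %/ d.+1)%N.
have dE : (d.+1 <= size E)%N by rewrite -(ler_nat R) (le_trans dn) // ltW.
have q0 : (0 < q)%N by rewrite divn_gt0.
have idx i : (i <= d)%N -> (i * q < size E)%N.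
  move=> id; apply: leq_trans (_ : d.+1 * q <= _)%N.
    by rewrite ltn_pmul2r.
  by rewrite mulnC leq_trunc_div.
have sortE : sorted ltn E by rewrite sorted_filter ?iota_ltn_sorted //; exact: ltn_trans.
(* [E] is a strictly increasing list of integers, so keeping every [q]-th entry gives nodes at
   distance at least [q]. *)
have gap i k : (i + k < size E)%N -> (nth 0%N E i + k <= nth 0%N E (i + k))%N.
  elim: k => [|k IH]; first by rewrite !addn0.
  rewrite !addnS => h; apply: leq_ltn_trans (IH (ltnW h)) _.
  by apply: (sorted_ltn_nth ltn_trans) => //; rewrite inE // ltnW.
have memE i : (i <= d)%N -> nth 0%N E (i * q) \in E by move=> id; rewrite mem_nth ?idx.
have ok : n%:R <= 2 * d.+1%:R / dl * q%:R; last first.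
  move: px; rewrite ltNge => /negP; apply.
  apply: (@poly_bound_separated R d p (fun i => (nth 0%N E (i * q))%:R) D n%:R _ q%:R)
    => //.
  - by rewrite ltr0n.
  - by move=> i /memE; rewrite mem_filter mem_iota add1n ltnS ler0n ler_nat => /and3P[].
  - move=> i j /andP[ij jd]; rewrite lerBrDr -natrD ler_nat addnC.
    have -> : (j * q = i * q + (j - i) * q)%N by rewrite -mulnDl subnKC // ltnW.
    apply: leq_trans (gap _ _ _).
      by rewrite leq_add2l leq_pmull // subn_gt0.
    by rewrite -mulnDl subnKC ?idx // ltnW.
  - by move=> i /memE; rewrite mem_filter => /andP[].
rewrite mulrAC ler_pdivlMr // mulrC (le_trans (ltW cn)) //.
rewrite -!natrM ler_nat.
(* As [q] is positive, the remainder is below [q * d.+1], hence [size E <= 2 * d.+1 * q]; this is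
   the factor 2 in the ratio. *)
have := divn_eq (size E) d.+1; rewrite -/q => ->.
have : (size E %% d.+1 < d.+1)%N by rewrite ltn_mod.
move: (size E %% d.+1)%N => u ud.
have -> : (2 * d.+1 * q = q * d.+1 + q * d.+1)%N by rewrite -mulnA (mulnC d.+1) mul2n addnn.
rewrite leq_add2l.
by apply: leq_trans (ltnW ud) _; rewrite leq_pmull.
Qed.

(** * Forward recursion *)

Section forward.
Variables (R : realFieldType) (T : finType).
Implicit Types (mu : T -> R) (Q : T -> T -> R) (phi : nat -> T -> R).

(** The unnormalised forward variables of a hidden Markov model: the total weight, emissions
    included, of the paths that are in [a] at index [m]. *)
Fixpoint fwd mu Q phi (m : nat) (a : T) : R :=
  match m with
  | 0 => mu a * phi 0%N a
  | m'.+1 => (\sum_b fwd mu Q phi m' b * Q b a) * phi m'.+1 a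
  end.

Definition path_weight mu Q m (x : {ffun 'I_m.+1 -> T}) : R :=
  mu (x ord0) * \prod_(i < m) Q (x (widen_ord (leqnSn m) i)) (x (lift ord0 i)).

Lemma sum_ffunS m (F : {ffun 'I_m.+1 -> T} -> R) :
  \sum_x F x = \sum_(a : T) \sum_(y : {ffun 'I_m -> T})
     F [ffun i => if unlift ord_max i is Some j then y j else a].
Proof.
pose h (p : T * {ffun 'I_m -> T}) : {ffun 'I_m.+1 -> T} :=
  [ffun i => if unlift ord_max i is Some j then p.2 j else p.1].
rewrite pair_bigA /= (reindex h) /=; first by [].
exists (fun x => (x ord_max, [ffun j => x (lift ord_max j)])).
  move=> [a y] _; rewrite /h /= ffunE unlift_none; congr (_, _).
  by apply/ffunP => j; rewrite !ffunE liftK.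
move=> x _; apply/ffunP => i; rewrite !ffunE.
by case: unliftP => [j ->|->] //=; rewrite ffunE.
Qed.

(** Forward algorithm: removing the last state leaves a path one step shorter, and the sum is
    regrouped according to the penultimate state. *)
Lemma sum_path_weight_last mu Q phi m (a : T) :
  \sum_(x : {ffun 'I_m.+1 -> T} | x ord_max == a)
     path_weight mu Q x * \prod_(i < m.+1) phi i (x i) = fwd mu Q phi m a.
Proof.
elim: m a => [|m IH] a.
  rewrite big_mkcond sum_ffunS /= (bigD1 a) //= [X in _ + X]big1 ?addr0.
    have e1 : #|{ffun 'I_0 -> T}| = 1%N by rewrite card_ffun card_ord expn0.
    rewrite (eq_bigr (fun=> mu a * phi 0%N a)); last first.
      move=> y _; rewrite ffunE unlift_none eqxx /path_weight big_ord0 mulr1.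
      by rewrite big_ord1 !ffunE; case: unliftP => [[]|].
    by rewrite sumr_const e1.
  move=> b ba; rewrite big1 // => y _; rewrite ffunE unlift_none.
  by rewrite (negPf ba).
rewrite big_mkcond sum_ffunS /= (bigD1 a) //= [X in _ + X]big1 ?addr0; last first.
  move=> b ba; rewrite big1 // => y _; rewrite ffunE unlift_none.
  by rewrite (negPf ba).
rewrite -(eq_bigr _ (fun b _ => congr1 (fun z => z * Q b a) (IH b))) /= mulr_suml.
under [RHS]eq_bigr do rewrite mulr_suml mulr_suml.
rewrite (exchange_big_dep xpredT) //=; apply: eq_bigr => y _.
rewrite (big_pred1 (y ord_max)) => [|b]; last by rewrite /= eq_sym.
rewrite ffunE unlift_none eqxx.
set x := (X in path_weight mu Q X).
have xl (j : 'I_m.+1) : x (lift ord_max j) = y j by rewrite ffunE liftK.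
have wl (j : 'I_m.+1) : widen_ord (leqnSn m.+1) j = lift ord_max j.
  by apply: val_inj; rewrite /= /bump leqNgt ltn_ord.
have xm : x ord_max = a by rewrite ffunE unlift_none.
rewrite [in X in _ * X]big_ord_recr /= xm.
under [in X in _ * X]eq_bigr do rewrite wl xl.
rewrite /path_weight big_ord_recr /= wl xl.
have -> : lift ord0 (ord_max : 'I_m.+1) = ord_max by apply: val_inj.
rewrite xm.
have -> : x ord0 = y ord0.
  by rewrite -xl; congr (x _); apply: val_inj.
under eq_bigr => i _.
  rewrite wl xl (_ : lift ord0 (widen_ord (leqnSn m) i) = lift ord_max (lift ord0 i));
    last by apply: val_inj; rewrite /= /bump /= leqNgt !add1n ltnS ltn_ord.
  rewrite xl; over.
ring.
Qed.

Lemma sum_path_weight mu Q phi m :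
  \sum_(x : {ffun 'I_m.+1 -> T})
     path_weight mu Q x * \prod_(i < m.+1) phi i (x i) = \sum_a fwd mu Q phi m a.
Proof.
rewrite (partition_big (fun x : {ffun 'I_m.+1 -> T} => x ord_max) xpredT) //=.
by apply: eq_bigr => a _; exact: sum_path_weight_last.
Qed.

Lemma path_weight_ge0 mu Q m (x : {ffun 'I_m.+1 -> T}) :
  (forall a, 0 <= mu a) -> (forall a b, 0 <= Q a b) -> 0 <= path_weight mu Q x.
Proof. by move=> mu0 Q0; rewrite mulr_ge0 // prodr_ge0. Qed.

Lemma fwd_ge0 mu Q phi m a : (forall a, 0 <= mu a) -> (forall a b, 0 <= Q a b) ->
  (forall i a, 0 <= phi i a) -> 0 <= fwd mu Q phi m a.
Proof.
move=> mu0 Q0 p0; elim: m a => [|m IH] a /=; rewrite mulr_ge0 //.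
by rewrite sumr_ge0 // => b _; rewrite mulr_ge0.
Qed.

(** A bound on one step that is uniform in the previous state multiplies along the recursion. It
    serves both for the Laplace transform of a visit count and for the upper bound on the
    likelihood. *)
Lemma sum_fwd_le mu Q phi (B : nat -> R) m :
  (forall a, 0 <= mu a) -> (forall a b, 0 <= Q a b) -> (forall i a, 0 <= phi i a) ->
  (forall i, 0 <= B i) ->
  \sum_a mu a * phi 0%N a <= B 0%N ->
  (forall i b, \sum_a Q b a * phi i.+1 a <= B i.+1) ->
  \sum_a fwd mu Q phi m a <= \prod_(i < m.+1) B i.
Proof.
move=> mu0 Q0 p0 B0 h0 hS; elim: m => [|m IH]; first by rewrite big_ord1.
rewrite big_ord_recr /=; apply: le_trans (_ : (\sum_b fwd mu Q phi m b) * B m.+1 <= _).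
  under eq_bigr do rewrite mulr_suml.
  rewrite exchange_big /= mulr_suml ler_sum // => b _.
  under eq_bigr do rewrite -mulrA.
  by rewrite -mulr_sumr ler_wpM2l ?fwd_ge0.
by rewrite ler_wpM2r.
Qed.

Lemma sum_path_weight_eq1 mu Q m : \sum_a mu a = 1 -> (forall a, \sum_b Q a b = 1) ->
  \sum_(x : {ffun 'I_m.+1 -> T}) path_weight mu Q x = 1.
Proof.
move=> mu1 Q1.
have := sum_path_weight mu Q (fun _ _ => 1) m.
under eq_bigr do rewrite big1 // mulr1.
move=> ->; elim: m => [|m IH] /=; first by under eq_bigr do rewrite mulr1.
under eq_bigr do rewrite mulr1.
by rewrite exchange_big /=; under eq_bigr do rewrite -mulr_sumr Q1 mulr1.
Qed.

End forward.

(* Deleting the state [x0]: a visit to [x0] at time [i] is charged to the state [c i]. *)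
Lemma fwd_delete_state (R : realFieldType) (k : nat) (x0 : 'I_k.+1) (s : R)
    (mu : 'I_k.+1 -> R) (Q : 'I_k.+1 -> 'I_k.+1 -> R) (phi : nat -> 'I_k.+1 -> R)
    (Q' : 'I_k -> 'I_k -> R) (c : nat -> 'I_k) (rho : nat -> R) (m : nat) :
  0 < s < 1 -> (forall a, 0 <= mu a <= 1) ->
  (forall a b, 0 <= Q a b <= 1) ->
  (forall a b, s <= Q' a b) ->
  (forall a b, Q (lift x0 a) (lift x0 b) <= (1 - s) * Q' a b) ->
  (forall i a, 0 <= phi i a) -> (forall i, 0 <= rho i) ->
  (forall i, phi i x0 <= rho i * phi i (lift x0 (c i))) ->
  \sum_a fwd mu Q phi m a <=
    (k%:R / (1 - s)) * \prod_(i < m.+1) ((1 - s) + rho i / (s * (1 - s)) / s)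
     * \sum_a fwd (fun=> k%:R^-1) Q' (fun i a => phi i (lift x0 a)) m a.
Proof.
move=> /andP[s0 s1] mu01 Q01 Q's QQ' p0 rho0 prho.
have s1' : 0 < 1 - s by rewrite subr_gt0.
have s0w := ltW s0; have s1w := ltW s1'.
have k0 : (0 < k)%N by exact: leq_ltn_trans (leq0n _) (ltn_ord (c 0%N)).
have kR : (0 < k%:R :> R) by rewrite ltr0n.
(* The factor [1 / s] pays for rerouting an entry into [x0] through a transition of weight at least
   [s]; the factor [1 / (1 - s)] is there so that [(1 - s) * (1 + kap i) <= F i] can close the
   induction. *)
have [kap kapE] : exists kap : nat -> R, forall i, kap i = rho i / (s * (1 - s)).
  by eexists.
have kap0 i : 0 <= kap i by rewrite kapE divr_ge0 // mulr_ge0.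
have rk i : rho i <= kap i.
  rewrite kapE ler_pdivlMr ?mulr_gt0 //; have := rho0 i; nra.
have [F FE] : exists F : nat -> R, forall i, F i = (1 - s) + kap i / s.
  by eexists.
have F0 i : 0 <= F i by rewrite FE addr_ge0 ?divr_ge0.
(* The factor [k] compensates the uniform initial law of the reduced chain. *)
have [C CE] : exists C : nat -> R, forall n, C n = k%:R * \prod_(i < n) F i.
  by eexists.
have C0 n : 0 <= C n by rewrite CE mulr_ge0 ?prodr_ge0 ?ltW.
have CS n : C n.+1 = C n * F n by rewrite !CE big_ord_recr mulrA.
have Fk i : (1 - s) * (1 + kap i) <= F i.
  rewrite FE mulrDr mulr1 lerD2l ler_pdivlMr //.
  have : (1 - s) * s <= 1 by nra.
  have := kap0 i; nra.
have Q'0 a b : 0 <= Q' a b by apply: le_trans (Q's a b); exact: ltW.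
set phi' := fun i a => phi i (lift x0 a).
set al := fwd mu Q phi; set al' := fwd _ Q' phi'.
have al'0 n a : 0 <= al' n a.
  by apply: fwd_ge0 => [_|x y|i x]; rewrite ?invr_ge0 /phi'.
have Q0 a b : 0 <= Q a b by have /andP[] := Q01 a b.
have al0 n a : 0 <= al n a.
  by apply: fwd_ge0 => // b; have /andP[] := mu01 b.
(* Joint invariant: each surviving state is dominated by its own reduced weight, and [x0] by [kap n]
   times the reduced weight of its substitute [c n]. In [F n], the term [1 - s] comes from
   transitions between survivors and [kap n / s] from those leaving [x0]. *)
have main n : (forall b, al n (lift x0 b) <= C n * al' n b) /\
    al n x0 <= C n * (kap n * al' n (c n)).
  elim: n => [|n [IH1 IH2]].
    rewrite CE big_ord0 mulr1; split => [b|] /=.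
      by rewrite mulrA divff ?gt_eqF // mul1r ler_piMl // ; have /andP[] := mu01 (lift x0 b).
    rewrite mulrCA (mulrA k%:R) divff ?gt_eqF // mul1r.
    apply: le_trans (_ : phi 0%N x0 <= _).
      by rewrite ler_piMl //; have /andP[] := mu01 x0.
    by rewrite (le_trans (prho _)) // ler_wpM2r.
  have step (z : 'I_k.+1) : \sum_b al n b * Q b z <=
      C n * (kap n * al' n (c n) * Q x0 z + \sum_b al' n b * Q (lift x0 b) z).
    rewrite (bigD1_ord x0) //= mulrDr mulr_sumr lerD //.
      by rewrite mulrA ler_wpM2r //; have /andP[] := Q01 x0 z.
    apply: ler_sum => b _; by rewrite mulrA ler_wpM2r //.
  split => [b|] /=.
    rewrite -/al -/al' /phi' CS mulrA ler_wpM2r // (le_trans (step _)) //.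
    rewrite -(mulrA (C n)) ler_wpM2l // FE mulrDl addrC lerD //.
      by rewrite mulr_sumr ler_sum // => a _; rewrite mulrCA ler_wpM2l.
    apply: le_trans (_ : kap n * al' n (c n) <= _).
      by rewrite ler_piMr ?mulr_ge0 //; have /andP[] := Q01 x0 (lift x0 b).
    rewrite -!mulrA ler_wpM2l // mulrC ler_pdivlMr //.
    rewrite (bigD1 (c n)) //=; apply: le_trans (_ : al' n (c n) * Q' (c n) b <= _).
      by rewrite ler_wpM2l.
    by rewrite lerDl sumr_ge0 // => a _; rewrite mulr_ge0.
  rewrite -/al -/al'.
  set S' := \sum_b al' n b * Q' b (c n.+1).
  have S'a : s * \sum_b al' n b <= S'.
    by rewrite mulr_sumr ler_sum // => b _; rewrite mulrC ler_wpM2l.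
  have S'0 : 0 <= S' by rewrite sumr_ge0 // => b _; rewrite mulr_ge0.
  have h1 : \sum_b al n b * Q b x0 <= C n * ((1 + kap n) * (S' / s)).
    rewrite (le_trans (step _)) // ler_wpM2l // addrC mulrDl mul1r lerD //.
      rewrite ler_pdivlMr // mulrC (le_trans _ S'a) // ler_wpM2l //.
      by rewrite ler_sum // => b _; rewrite ler_piMr //; have /andP[] := Q01 (lift x0 b) x0.
    apply: le_trans (_ : kap n * al' n (c n) <= _).
      by rewrite ler_piMr ?mulr_ge0 //; have /andP[] := Q01 x0 x0.
    rewrite ler_wpM2l // ler_pdivlMr // mulrC (le_trans _ S'a) // ler_wpM2l //.
    by rewrite (bigD1 (c n)) //= lerDl sumr_ge0.
  apply: le_trans (_ : C n * ((1 + kap n) * (S' / s)) *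
    (rho n.+1 * phi n.+1 (lift x0 (c n.+1))) <= _).
    by rewrite ler_pM ?sumr_ge0 // => b _; rewrite mulr_ge0.
  have -> : al' n.+1 (c n.+1) = S' * phi n.+1 (lift x0 (c n.+1)) by [].
  have := p0 n.+1 (lift x0 (c n.+1)); set ph := phi _ _ => ph0.
  (* Here [rho / s] is rewritten as [(1 - s) * kap]. *)
  have -> : C n * ((1 + kap n) * (S' / s)) * (rho n.+1 * ph) =
     C n * (((1 - s) * (1 + kap n)) * (kap n.+1 * (S' * ph))).
    by rewrite (kapE n.+1); field; rewrite !gt_eqF.
  by rewrite CS -(mulrA (C n)) ler_wpM2l // ler_wpM2r // !mulr_ge0.
have [h1 h2] := main m.
rewrite (bigD1_ord x0) //=.
(* At the last index [x0] adds a proportion of at most [kap m]; completing the product with [F m]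
   leaves the factor [1 / (1 - s)]. *)
apply: le_trans (_ : C m * (1 + kap m) * \sum_a al' m a <= _).
  rewrite mulrDr mulr1 mulrDl addrC lerD //.
    by rewrite mulr_sumr ler_sum.
  rewrite (le_trans h2) // mulrA ler_wpM2l ?mulr_ge0 //.
  by rewrite (bigD1 (c m)) //= lerDl sumr_ge0.
rewrite ler_wpM2r ?sumr_ge0 // big_ord_recr /=.
have -> : k%:R / (1 - s) * (\prod_(i < m) (1 - s + rho i / (s * (1 - s)) / s) *
  (1 - s + rho m / (s * (1 - s)) / s)) = C m * (F m / (1 - s)).
  rewrite CE FE kapE.
  have -> : \prod_(i < m) (1 - s + rho i / (s * (1 - s)) / s) = \prod_(i < m) F i.
    by apply: eq_bigr => i _; rewrite FE kapE.
  by ring.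
by rewrite ler_wpM2l // ler_pdivlMr // mulrC.
Qed.

(** * Empirical averages *)

Section borel_cantelli.
Context {R : realType} {d0 : measure_display} {Omega : measurableType d0}.
Variable P : probability Omega R.

Lemma borel_cantelli_eventually (E : nat -> set Omega) (C : R) :
  (forall k, measurable (E k)) ->
  (forall n, (\sum_(0 <= k < n) P (E k) <= C%:E)%E) ->
  {ae P, forall w, exists k0 : nat, forall k : nat, (k0 <= k)%N -> ~ E k w}.
Proof.
move=> mE EC; exists (lim_sup_set E); split.
- by apply: bigcap_measurable => // n _; exact: bigcup_measurable.
- apply: lim_sup_set_cvg0 => //; apply: le_lt_trans (ltry C).
  apply: lime_le; first exact: is_cvg_nneseries.
  by apply: nearW => n; exact: EC.
move=> w /= nw n _; apply: contrapT => nE; apply: nw; exists n => k nk Ek.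
by apply: nE; exists k.
Qed.

(** Chebyshev's inequality for a sum of indicators, whose variance is read off the pairwise
    intersections. *)
Lemma indic_sum_chebyshev (I : finType) (A : I -> set Omega) (p : I -> R)
    (q : I -> I -> R) (lam : R) :
  (forall i, measurable (A i)) -> (forall i, P (A i) = (p i)%:E) ->
  (forall i j, P (A i `&` A j) = (q i j)%:E) -> 0 < lam ->
  (P [set w | (\sum_i p i + lam <= \sum_i \1_(A i) w)%R] <=
   ((\sum_i \sum_j q i j - (\sum_i p i) ^+ 2) / lam ^+ 2)%:E)%E.
Proof.
move=> mA pA qA lam0.
pose S w : R := \sum_i \1_(A i) w.
pose mu : R := \sum_i p i.
have mind (B : set Omega) : measurable B ->
    measurable_fun setT (EFin \o (\1_B : Omega -> R)).
  by move=> mB; apply/measurable_EFinP; exact: measurable_indic.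
have mS : measurable_fun setT S by apply: measurable_sum => i; exact: measurable_indic.
have S0 w : 0 <= S w by rewrite sumr_ge0.
have p0 i : 0 <= p i by rewrite -lee_fin -pA.
have mu0 : 0 <= mu by rewrite sumr_ge0.
have intS : (\int[P]_w (S w)%:E = mu%:E)%E.
  under eq_integral do rewrite /S -sumEFin.
  rewrite ge0_integral_sum //; last by move=> i; exact: mind.
  rewrite /mu -sumEFin; apply: eq_bigr => i _.
  by rewrite integral_indic // setIT; exact: pA.
have intS2 : (\int[P]_w (S w ^+ 2)%:E = (\sum_i \sum_j q i j)%:E)%E.
  have SE w : ((S w ^+ 2)%:E = \sum_(ij : I * I) (\1_(A ij.1 `&` A ij.2) w)%:E)%E.
    rewrite sumEFin; congr EFin; rewrite expr2 /S mulr_suml.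
    rewrite -(pair_bigA _ (fun i j => \1_(A i `&` A j) w)) /=.
    apply: eq_bigr => i _; rewrite mulr_sumr; apply: eq_bigr => j _.
    by rewrite indicI.
  under eq_integral do rewrite SE.
  rewrite ge0_integral_sum //; last by move=> i; apply: mind; exact: measurableI.
  rewrite pair_bigA /= -sumEFin; apply: eq_bigr => i _.
  rewrite integral_indic ?setIT; [exact: qA|by []|exact: measurableI].
have mD : measurable_fun setT (EFin \o (fun w => (S w - mu) ^+ 2)).
  by apply/measurable_EFinP; apply: measurable_funX; exact: measurable_funB.
(* The cross term is moved to the left, [(S - mu)^2 + 2 mu S = S^2 + mu^2], so that only nonnegative
   functions are integrated. *)
have intD : (\int[P]_w ((S w - mu) ^+ 2)%:E + (2 * mu * mu)%:E =
    (\sum_i \sum_j q i j + mu ^+ 2)%:E)%E.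
  rewrite [in RHS]EFinD -intS2.
  have -> : ((mu ^+ 2)%:E = \int[P]_w (mu ^+ 2)%:E)%E.
    by rewrite integral_cst // [X in (_ * X)%E]probability_setT mule1.
  rewrite -ge0_integralD //; last 3 first.
  - by move=> w _; rewrite lee_fin sqr_ge0.
  - by apply/measurable_EFinP; exact: measurable_funX.
  - by move=> w _; rewrite lee_fin sqr_ge0.
  rewrite EFinM -intS -ge0_integralZl_EFin //; last 3 first.
  - by move=> w _; rewrite lee_fin.
  - exact/measurable_EFinP.
  - by rewrite mulr_ge0.
  rewrite -ge0_integralD //; last 3 first.
  - by move=> w _; rewrite lee_fin sqr_ge0.
  - by move=> w _; rewrite -EFinM lee_fin !mulr_ge0.
  - by apply/measurable_EFinP; exact: measurable_funM.
  by apply: eq_integral => w _; rewrite -EFinM -!EFinD; congr EFin; ring.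
have intD' : (\int[P]_w ((S w - mu) ^+ 2)%:E = (\sum_i \sum_j q i j - mu ^+ 2)%:E)%E.
  move: intD; case: (integral _ _ _) => [r| |] //=; rewrite -EFinD => -[] h.
  by congr EFin; lra.
pose E := [set w | mu + lam <= S w].
have mE : measurable E.
  by rewrite /E -[X in measurable X]setTI; exact: measurable_fun_le.
rewrite -/mu -/E EFinM lee_pdivlMr ?exprn_gt0 // -intD' muleC.
have -> : ((lam ^+ 2)%:E * P E = \int[P]_w ((lam ^+ 2)%:E * (\1_E w)%:E))%E.
  rewrite ge0_integralZl_EFin ?sqr_ge0 //; last exact: mind.
  by rewrite integral_indic // setIT.
apply: ge0_le_integral => //.
- by move=> w _; rewrite -EFinM lee_fin mulr_ge0 // sqr_ge0.
- by apply: measurable_funeM; exact: mind.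
move=> w _; rewrite -EFinM lee_fin indicE.
case: (boolP (w \in E)) => [|_]; last by rewrite mulr0 sqr_ge0.
rewrite inE /E /= mulr1 => h; rewrite ler_sqr ?nnegrE; lra.
Qed.

End borel_cantelli.

Lemma indic_ltE {R : realType} (T : Type) (f : T -> R) (a : R) (w : T) :
  \1_[set w | a < f w] w = ((a < f w)%R)%:R :> R.
Proof. by rewrite indicE (_ : (w \in _) = (a < f w)) //; apply/idP/idP; rewrite inE. Qed.

(** Layer-cake formula with mesh [h]: counting the levels below [v] recovers [v] up to one mesh. The
    converse inequality requires that [v] not exceed the top level. *)
Lemma layer_le (R : realType) (h v : R) (L : nat) : 0 < h -> 0 <= v ->
  h * \sum_(j < L) ((h * j%:R < v)%R)%:R <= v + h.
Proof.
move=> h0 v0; elim: L => [|L IH]; first by rewrite big_ord0 mulr0 addr_ge0 // ltW.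
rewrite big_ord_recr /=; case: ltP => [hL|_]; last by rewrite addr0.
have : \sum_(j < L) ((h * j%:R < v)%R)%:R <= L%:R :> R.
  apply: le_trans (_ : \sum_(j < L) 1 <= _); last by rewrite sumr_const card_ord.
  by apply: ler_sum => j _; case: ltP.
move=> hs; apply: le_trans (_ : h * (L%:R + 1) <= _); last by rewrite mulrDr mulr1 lerD2r ltW.
by rewrite ler_wpM2l ?lerD2r // ltW.
Qed.

Lemma layer_ge (R : realType) (h v : R) (L : nat) : 0 < h -> v <= h * L%:R ->
  v <= h * \sum_(j < L) ((h * j%:R < v)%R)%:R.
Proof.
move=> h0; elim: L => [|L IH]; first by rewrite big_ord0.
case: (ltP (h * L%:R) v) => [hL|/IH vL] vL1.
  rewrite (eq_bigr (fun=> 1)) ?sumr_const ?card_ord // => j _.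
  suff -> : h * j%:R < v by [].
  by apply: le_lt_trans hL; rewrite ler_pM2l // ler_nat -ltnS.
rewrite (le_trans vL) // ler_pM2l // big_ord_recr /= lerDl.
exact: ler0n.
Qed.

(** Exactly [2 * j + 1] pairs of indices have maximum [j]. *)
Lemma sum_max_index (R : realType) (p : nat -> R) (L : nat) :
  \sum_(i < L) \sum_(j < L) p (maxn i j) = \sum_(j < L) (2 * j%:R + 1) * p j.
Proof.
elim: L => [|L IH]; first by rewrite !big_ord0.
rewrite big_ord_recr [in RHS]big_ord_recr /= -IH.
under eq_bigr do rewrite big_ord_recr /=.
rewrite big_split /= -addrA; congr (_ + _).
rewrite big_ord_recr /= maxnn.
rewrite (eq_bigr (fun=> p L)); last by move=> i _; rewrite (maxn_idPr _) // ltnW.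
rewrite [X in _ + (X + _)](eq_bigr (fun=> p L)); last first.
  by move=> i _; rewrite (maxn_idPl _) // ltnW.
by rewrite sumr_const card_ord -mulr_natl; ring.
Qed.

(* [b k] is the variance bound of the dyadic block [2 ^ k] divided by [4 ^ k];
   it obeys [b (k + 1) <= b k / 2 + 2 \sum_(2^k <= j < 2^(k+1)) p j]. *)
Lemma dyadic_sum_le (R : realType) (p : nat -> R) (C : R) :
  (forall j, 0 <= p j) ->
  (forall L, \sum_(j < L) p j <= C) ->
  forall K, \sum_(k < K) ((\sum_(j < 2 ^ k) (2 * j%:R + 1) * p j) / (2 ^ k)%:R) <= 4 * C.
Proof.
move=> p0 pC.
pose b k : R := (\sum_(j < 2 ^ k) (2 * j%:R + 1) * p j) / (2 ^ k)%:R.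
have b0 k : 0 <= b k.
  by rewrite divr_ge0 // sumr_ge0 // => j _; rewrite mulr_ge0 // addr_ge0 // mulr_ge0.
have C0 : 0 <= C by have := pC 0%N; rewrite big_ord0.
(* The extra [b K] is a potential that pays for the half carried over to the next block; the step is
   left with the terms of one dyadic block, where [2 * j + 1 <= 4 * 2 ^ K]. *)
have key K : \sum_(k < K.+1) b k + b K <= 4 * \sum_(j < 2 ^ K) p j.
  elim: K => [|K IH].
    by rewrite big_ord1 /b expn0 big_ord1 big_ord1 /= divr1; have := p0 0%N; lra.
  rewrite big_ord_recr /=.
  suff : 2 * b K.+1 - b K <= 4 * (\sum_(j < 2 ^ K.+1) p j - \sum_(j < 2 ^ K) p j) by lra.
  have le2 : (2 ^ K <= 2 ^ K.+1)%N by rewrite leq_exp2l.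
  have n0 : 0 < (2 ^ K)%:R :> R by rewrite ltr0n expn_gt0.
  have split (F : nat -> R) : \sum_(j < 2 ^ K.+1) F j - \sum_(j < 2 ^ K) F j =
      \sum_(2 ^ K <= j < 2 ^ K.+1) F j.
    rewrite -(big_mkord xpredT F) -[X in _ - X](big_mkord xpredT F).
    by rewrite (big_cat_nat (leq0n _) le2) /= addrAC subrr add0r.
  have -> : 2 * b K.+1 - b K =
      (\sum_(j < 2 ^ K.+1) (2 * j%:R + 1) * p j - \sum_(j < 2 ^ K) (2 * j%:R + 1) * p j)
        / (2 ^ K)%:R.
    by rewrite /b expnS natrM; field; rewrite gt_eqF.
  rewrite (split (fun j => (2 * j%:R + 1) * p j)) split ler_pdivrMr // mulr_sumr mulr_suml.
  rewrite big_nat [leRHS]big_nat; apply: ler_sum => j /andP[_ jK].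
  rewrite -mulrA [X in 4 * X]mulrC mulrA ler_wpM2r //.
  have : (j.+1)%:R <= 2 * (2 ^ K)%:R :> R by rewrite -natrM ler_nat -expnS.
  rewrite -natr1; lra.
case=> [|K]; first by rewrite big_ord0 mulr_ge0.
apply: le_trans (_ : \sum_(k < K.+1) b k + b K <= _); first by rewrite lerDl.
by rewrite (le_trans (key K)) // ler_wpM2l.
Qed.

Lemma measurable_set_gt (R : realType) (d0 : measure_display)
    (T : measurableType d0) (f : T -> R) (a : R) :
  measurable_fun setT f -> measurable [set w | a < f w].
Proof.
by move=> mf; rewrite -preimage_itvoy -[X in measurable X]setTI; exact: mf.
Qed.

(** Chebyshev for the [n * L] indicators of the layers, with deviation [n]. Distinct times
    contribute no covariance, while at equal times the layers are nested. *)
Lemma truncated_sum_deviation (R : realType) (d0 : measure_display)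
    (Omega : measurableType d0) (P : probability Omega R) (V : nat -> Omega -> R)
    (h : R) (p : nat -> R) (n L : nat) :
  (forall t, measurable_fun setT (V t)) ->
  (forall t j, P [set w | h * j%:R < V t w] = (p j)%:E) ->
  (forall s t i j, s != t ->
     P ([set w | h * i%:R < V s w] `&` [set w | h * j%:R < V t w]) =
     ((p i)%:E * (p j)%:E)%E) ->
  0 <= h -> (0 < n)%N ->
  (P [set w | (n%:R * \sum_(j < L) p j + n%:R <=
      \sum_(t < n) \sum_(j < L) ((h * j%:R < V t w)%R)%:R)%R] <=
    ((\sum_(j < L) (2 * j%:R + 1) * p j) / n%:R)%:E)%E.
Proof.
move=> mV pV indV h0 n0.
pose A (ij : 'I_n * 'I_L) := [set w | h * ij.2%:R < V ij.1 w].
(* At a common time the intersection of two nested layers is the higher one. *)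
pose q (a b : 'I_n * 'I_L) := if a.1 == b.1 then p (maxn a.2 b.2) else p a.2 * p b.2.
have nR : 0 < n%:R :> R by rewrite ltr0n.
have p0 j : 0 <= p j by rewrite -lee_fin -(pV 0%N).
have mA ij : measurable (A ij).
  exact: measurable_set_gt.
have qA a b : P (A a `&` A b) = (q a b)%:E.
  rewrite /q; case: eqP => [ab|/eqP ab]; last by rewrite indV // EFinM.
  rewrite -(pV a.1); congr (P _); apply/seteqP; split => w /=.
    by rewrite /A /= -ab /maxn; case: ifP => _ [].
  rewrite /A /= -ab => hw; split; apply: le_lt_trans hw.
    by rewrite ler_wpM2l // ler_nat leq_maxl.
  by rewrite ler_wpM2l // ler_nat leq_maxr.
have := @indic_sum_chebyshev R _ _ P _ A (fun ij => p ij.2) q n%:R mA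
  (fun ij => pV ij.1 ij.2) qA nR.
have sp : \sum_(ij : 'I_n * 'I_L) p ij.2 = n%:R * \sum_(j < L) p j.
  rewrite -(pair_bigA _ (fun (i : 'I_n) (j : 'I_L) => p j)) /=.
  by rewrite sumr_const card_ord mulr_natl.
have -> : [set w | \sum_(ij : 'I_n * 'I_L) p ij.2 + n%:R <=
      \sum_(ij : 'I_n * 'I_L) \1_(A ij) w] =
   [set w | n%:R * \sum_(j < L) p j + n%:R <=
      \sum_(t < n) \sum_(j < L) ((h * j%:R < V t w)%R)%:R].
  apply: eq_set => w; rewrite sp pair_bigA /=.
  by congr (is_true (_ <= _)); apply: eq_bigr => ij _; rewrite indic_ltE.
move=> /le_trans; apply; rewrite lee_fin ler_pdivrMr ?exprn_gt0 //.
rewrite expr2 mulrA divfK ?gt_eqF //.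
rewrite -sum_max_index sp lerBlDr.
have -> : n%:R * (\sum_(j < L) p j) * (n%:R * \sum_(j < L) p j) =
    \sum_(a : 'I_n * 'I_L) \sum_(b : 'I_n * 'I_L) p a.2 * p b.2.
  by rewrite -sp mulr_suml; apply: eq_bigr => a _; rewrite mulr_sumr.
have -> : (\sum_(i < L) \sum_(j < L) p (maxn i j)) * n%:R =
    \sum_(a : 'I_n * 'I_L) \sum_(b : 'I_n * 'I_L) (if a.1 == b.1 then p (maxn a.2 b.2) else 0).
  rewrite mulrC mulr_natl -[X in _ *+ X]card_ord -sumr_const.
  rewrite -[RHS](pair_bigA _ (fun (t : 'I_n) (i : 'I_L) => \sum_(b : 'I_n * 'I_L)
    (if t == b.1 then p (maxn i b.2) else 0))) /=.
  apply: eq_bigr => t _; apply: eq_bigr => i _.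
  rewrite -(pair_bigA _ (fun (s : 'I_n) (j : 'I_L) => if t == s then p (maxn i j) else 0)) /=.
  rewrite (bigD1 t) //= [X in _ + X]big1 ?addr0; first by rewrite eqxx.
  by move=> s /negPf st; rewrite big1 // => j _; rewrite eq_sym st.
rewrite -big_split /=; apply: ler_sum => a _.
rewrite -big_split /=; apply: ler_sum => b _.
by rewrite /q; case: ifP => _; [rewrite lerDl mulr_ge0|rewrite add0r].
Qed.

(** As in Etemadi's proof of the strong law, pairs of times and dyadic sample sizes are enough,
    because nonnegative sums increase with [n]. Comparing [n] with the next power of two costs the
    factor 2. *)
Lemma avg_le_eventually (R : realType) (d0 : measure_display)
    (Omega : measurableType d0) (P : probability Omega R) (V : nat -> Omega -> R) (c e : R) :
  (forall t, measurable_fun setT (V t)) ->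
  (forall t w, 0 <= V t w) ->
  (\int[P]_w (V 0%N w)%:E <= e%:E)%E ->
  (forall t a, P [set w | a < V t w] = P [set w | a < V 0%N w]) ->
  (forall s t a b, s != t ->
     P ([set w | a < V s w] `&` [set w | b < V t w]) =
     (P [set w | (a < V s w)%R] * P [set w | (b < V t w)%R])%E) ->
  2 * e < c ->
  {ae P, forall w, exists n0 : nat, forall n : nat, (n0 <= n)%N ->
     \sum_(i < n) V i w <= c * n%:R}.
Proof.
move=> mV V0 iV idV indV ec.
(* Chosen so that [e + 2 * h = c / 2]: one [h] is the mesh error, the other the allowed
   deviation. *)
pose h := (c - 2 * e) / 4.
have h0 : 0 < h by rewrite divr_gt0 // subr_gt0.
have h0w := ltW h0.
have mS t a : measurable [set w | a < V t w].
  exact: measurable_set_gt.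
pose p j := fine (P [set w | h * j%:R < V 0%N w]).
have pV t j : P [set w | h * j%:R < V t w] = (p j)%:E.
  by rewrite idV /p fineK // fin_num_measure.
have p0 j : 0 <= p j by exact: fine_ge0.
have pV2 s t i j : s != t ->
    P ([set w | h * i%:R < V s w] `&` [set w | h * j%:R < V t w]) =
    ((p i)%:E * (p j)%:E)%E.
  by move=> st; rewrite indV // !pV.
have pdec i j : (i <= j)%N -> p j <= p i.
  move=> ij; rewrite -lee_fin -!(pV 0%N); apply: le_measure; rewrite ?inE //.
  by move=> w /=; apply: le_lt_trans; rewrite ler_wpM2l // ler_nat.
have psum L : \sum_(j < L) p j <= (e + h) / h.
  rewrite ler_pdivlMr // mulrC -lee_fin EFinD.
  apply: le_trans (_ : \int[P]_w (V 0%N w + h)%:E <= _)%E; last first.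
    under eq_integral do rewrite EFinD.
    rewrite ge0_integralD //; last 2 first.
    - by move=> w _; rewrite lee_fin.
    - exact/measurable_EFinP.
    by rewrite integral_cst // [X in (_ + _ * X)%E]probability_setT mule1 leeD2r.
  apply: le_trans (_ : \int[P]_w (h * \sum_(j < L) \1_[set w | (h * j%:R < V 0%N w)%R] w)%:E <= _)%E.
    under eq_integral do rewrite EFinM -sumEFin.
    rewrite ge0_integralZl_EFin //; last 2 first.
    - by move=> w _; rewrite sumEFin lee_fin sumr_ge0.
    - under eq_fun do rewrite sumEFin.
      by apply/measurable_EFinP; apply: measurable_sum => j; exact: measurable_indic.
    rewrite EFinM lee_pmul2l // -sumEFin ge0_integral_sum //; last first.
      by move=> j; apply/measurable_EFinP; exact: measurable_indic.
    apply: lee_sum => j _; rewrite integral_indic // setIT.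
    by have := pV 0%N j => /= <-.
  apply: ge0_le_integral => //.
  - by move=> w _; rewrite lee_fin mulr_ge0 // sumr_ge0.
  - apply/measurable_EFinP; apply: measurable_funM => //.
    by apply: measurable_sum => j; exact: measurable_indic.
  - by apply/measurable_EFinP; exact: measurable_funD.
  move=> w _; rewrite lee_fin.
  under eq_bigr do rewrite indic_ltE.
  exact: layer_le.
pose b k := (\sum_(j < 2 ^ k) (2 * j%:R + 1) * p j) / (2 ^ k)%:R.
(* The two exceptional events at size [2 ^ k]: in [F k] the layer count deviates, in [G k] some
   variable exceeds the truncation level [h * 2 ^ k]. Both have probability at most [b k]. *)
pose F k := [set w | (2 ^ k)%:R * \sum_(j < 2 ^ k) p j + (2 ^ k)%:R <=
      \sum_(t < 2 ^ k) \sum_(j < 2 ^ k) ((h * j%:R < V t w)%R)%:R :> R].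
pose G k := \big[setU/set0]_(t < 2 ^ k) [set w | h * (2 ^ k)%:R < V t w].
have mG k : measurable (G k) by exact: bigsetU_measurable.
have mF k : measurable (F k).
  rewrite /F -[X in measurable X]setTI; apply: measurable_fun_le => //.
  apply: measurable_sum => t; apply: measurable_sum => j.
  have -> : (fun w => ((h * j%:R < V t w)%R)%:R) = \1_[set w | h * j%:R < V t w] :> (_ -> R).
    by apply/funext => w; rewrite indic_ltE.
  exact: measurable_indic.
have PF k : (P (F k) <= (b k)%:E)%E.
  by apply: truncated_sum_deviation; rewrite // expn_gt0.
have PG k : (P (G k) <= (b k)%:E)%E.
  apply: le_trans (_ : \sum_(t < 2 ^ k) P [set w | (h * (2 ^ k)%:R < V t w)%R] <= _)%E.
    exact: (@Boole_inequality _ _ _ P (fun t => [set w | h * (2 ^ k)%:R < V t w])).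
  under eq_bigr do rewrite pV.
  rewrite sumEFin lee_fin sumr_const card_ord /b ler_pdivlMr ?ltr0n ?expn_gt0 //.
  (* As [p] decreases, this identity bounds [2 ^ k * p (2 ^ k)] by [b k]. *)
  have odd_sum n : \sum_(j < n) (2 * j%:R + 1) = n%:R * n%:R :> R.
    elim: n => [|n IH]; first by rewrite big_ord0 mul0r.
    by rewrite big_ord_recr /= IH -natr1; ring.
  rewrite -[p _ *+ _]mulr_natl mulrAC -odd_sum mulr_suml; apply: ler_sum => j _.
  by rewrite ler_wpM2l ?addr_ge0 ?mulr_ge0 // pdec // ltnW.
have bsum K := dyadic_sum_le p0 psum K.
have := @borel_cantelli_eventually R _ _ P (fun k => F k `|` G k) (2 * (4 * ((e + h) / h))).
have mFG k : measurable (F k `|` G k) by exact: measurableU.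
have PFG n : (\sum_(0 <= k < n) P (F k `|` G k) <= (2 * (4 * ((e + h) / h)))%:E)%E.
  apply: le_trans (_ : (2 * \sum_(k < n) b k)%:E <= _)%E; last first.
    by rewrite lee_fin ler_wpM2l.
  rewrite big_mkord mulr_sumr -sumEFin; apply: lee_sum => k _.
  apply: le_trans (_ : P (F k) + P (G k) <= _)%E; first exact: measureU2.
  by rewrite mulr2n mulrDl mul1r EFinD leeD.
move=> /(_ mFG PFG); apply: filterS => w [k0 hk].
exists (2 ^ k0)%N => n nk0.
have n0 : (0 < n)%N by rewrite (leq_trans _ nk0) // expn_gt0.
have /andP[kn nk] := trunc_log_bounds (isT : (1 < 2)%N) n0.
(* Thus [2 ^ k] is the least power of two above [n], and at most [2 * n]. *)
set k := (trunc_log 2 n).+1 in nk.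
have k0k : (k0 <= k)%N.
  by rewrite ltnW // -(ltn_exp2l _ _ (isT : (1 < 2)%N)) (leq_ltn_trans nk0).
have /not_orP[nF nG] := hk k k0k.
apply: le_trans (_ : \sum_(i < 2 ^ k) V i w <= _).
  rewrite -(big_mkord xpredT (fun i => V i w)) -(big_mkord xpredT (fun i => V i w)).
  by rewrite [leRHS](big_cat_nat (leq0n _) (ltnW nk)) /= lerDl sumr_ge0.
apply: le_trans (_ : h * \sum_(t < 2 ^ k) \sum_(j < 2 ^ k) ((h * j%:R < V t w)%R)%:R <= _).
  rewrite mulr_sumr; apply: ler_sum => t _; apply: layer_ge => //.
  rewrite leNgt; apply/negP => Vt; apply: nG.
  by rewrite /G -(bigcup_mkord _ (fun t => [set w | h * (2 ^ k)%:R < V t w])); exists t => /=.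
move/negP : nF; rewrite -ltNge => /ltW nF.
apply: le_trans (_ : h * ((2 ^ k)%:R * ((e + h) / h) + (2 ^ k)%:R) <= _).
  by rewrite ler_pM2l // (le_trans nF) // lerD2r ler_wpM2l.
have -> : h * ((2 ^ k)%:R * ((e + h) / h) + (2 ^ k)%:R) = (2 ^ k)%:R * (e + 2 * h).
  by field; rewrite gt_eqF.
have -> : e + 2 * h = c / 2 by rewrite /h; field.
have c0 : 0 <= c / 2.
  have : (0 <= e%:E)%E by apply: le_trans iV; apply: integral_ge0 => x _; rewrite lee_fin.
  rewrite lee_fin => e0; apply: divr_ge0 => //; lra.
have : (2 ^ k)%:R <= 2 * n%:R :> R by rewrite -natrM ler_nat /k expnS leq_mul2l.
move=> h2; apply: le_trans (_ : 2 * n%:R * (c / 2) <= _); first by rewrite ler_wpM2r.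
by rewrite le_eqVlt; apply/orP; left; apply/eqP; field.
Qed.

(** * Hidden chain and noise *)

Lemma measurable_forall_fin (d0 : measure_display) (T : measurableType d0) (I : finType)
    (A : I -> set T) :
  (forall i, measurable (A i)) -> measurable [set w | forall i, A i w].
Proof.
move=> mA; rewrite (_ : [set w | _] = \bigcap_(i in [set: I]) A i).
  by apply: fin_bigcap_measurable => // i _; exact: mA.
by apply/seteqP; split => [w Aw i _|w Aw i]; apply: Aw.
Qed.

Lemma indep_setC (R : realType) (d0 : measure_display) (T : measurableType d0)
    (P : probability T R) (A B : set T) : measurable A -> measurable B ->
  P (A `&` B) = (P A * P B)%E -> P (~` A `&` ~` B) = (P (~` A) * P (~` B))%E.
Proof.
move=> mA mB AB.
have mAB : measurable (A `&` B) by exact: measurableI.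
have mAC : measurable (~` A) by exact: measurableC.
have mBC : measurable (~` B) by exact: measurableC.
have fA := fin_num_measure P _ mA; have fB := fin_num_measure P _ mB.
have fAC := fin_num_measure P _ mAC.
have finlt C : measurable C -> (P C < +oo)%E by move=> mC; rewrite ltey_eq fin_num_measure.
have e1 : P (~` A `&` ~` B) = (P (~` A) - (P B - P (A `&` B)))%E.
  rewrite -setDE; transitivity (P (~` A) - P (~` A `&` B))%E.
    by apply: measureD => //; exact: finlt.
  congr (_ - _)%E; rewrite setIC -setDE setIC.
  by apply: measureD => //; exact: finlt.
rewrite e1 AB !probability_setC //.
rewrite -(fineK fA) -(fineK fB); set a := fine _; set b := fine _.
have h : 1 - a - (b - a * b) = (1 - a) * (1 - b) by ring.
exact: (congr1 EFin h).
Qed.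

Lemma measurable_bigmax (R : realType) (d0 : measure_display) (T : measurableType d0)
    (I : Type) (r : seq I) (F : I -> T -> R) :
  (forall i, measurable_fun setT (F i)) ->
  measurable_fun setT (fun w => \big[Num.max/0]_(i <- r) F i w).
Proof.
move=> mF; elim: r => [|i r IH].
  by under eq_fun do rewrite big_nil; exact: measurable_cst.
by under eq_fun do rewrite big_cons; exact: measurable_maxr.
Qed.

Section data.
Context (R : realType) (d0 : measure_display) (Omega : measurableType d0)
  (P : probability Omega R) (ts : param R)
  (X : nat -> Omega -> 'I_(pK ts)) (Z : 'I_(pK ts) -> nat -> Omega -> R)
  (s : R).
Hypotheses (s01 : 0 < s < 1) (hpi : prob_vector (@ppi R ts))
  (hQ : stoch_lb s (@pQ R ts)) (hg : forall x, is_density (@pgam R ts x))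
  (hdata : data_model P X Z).

Local Notation mu := (@ppi R ts).
Local Notation Q := (@pQ R ts).

(** The probability that at one given time the noises of all the states lie in [B]; events on [Zmax]
    have this form. *)
Definition noise_prob (B : set R) : \bar R :=
  (\prod_(k < pK ts) \int[@lebesgue_measure R]_(z in B) (@pgam R ts k z)%:E)%E.

Lemma noise_probT : noise_prob setT = 1%E.
Proof. by rewrite /noise_prob big1 // => k _; have [_ [_]] := hg k. Qed.

(** The event is the disjoint union, over the paths in [S], of the cylinders of the data model.
    Taking all paths, or whole lines for the noise, gives the two marginal laws. *)
Lemma joint_law (n : nat) (S : pred {ffun 'I_n.+1 -> 'I_(pK ts)}) (B : 'I_n.+1 -> set R) :
  (forall t, measurable (B t)) ->
  P [set w | S [ffun t : 'I_n.+1 => X t.+1 w] /\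
             forall (t : 'I_n.+1) k, B t (Z k t.+1 w)] =
  ((\sum_(x : {ffun 'I_n.+1 -> 'I_(pK ts)} | S x) path_weight mu Q x)%:E *
   \prod_(t < n.+1) noise_prob (B t))%E.
Proof.
move=> mB; have [mX [mZ law]] := hdata.
pose E (x : {ffun 'I_n.+1 -> 'I_(pK ts)}) :=
  [set w | forall t : 'I_n.+1, X t.+1 w = x t /\ forall k, B t (Z k t.+1 w)].
pose r := [seq x <- index_enum {ffun 'I_n.+1 -> 'I_(pK ts)} | S x].
have -> : [set w | S [ffun t : 'I_n.+1 => X t.+1 w] /\
             forall (t : 'I_n.+1) k, B t (Z k t.+1 w)] = \bigcup_(x in [set` r]) E x.
  apply/seteqP; split => [w [Sw Bw]|w [x]] /=.
    exists [ffun t : 'I_n.+1 => X t.+1 w]; first by rewrite /= mem_filter Sw mem_index_enum.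
    by move=> t; rewrite ffunE; split => // k; exact: Bw.
  rewrite mem_filter => /andP[Sx _] Ex.
  have -> : [ffun t : 'I_n.+1 => X t.+1 w] = x.
    by apply/ffunP => t; rewrite ffunE; have [] := Ex t.
  by split => // t k; have [_] := Ex t; apply.
have mE x : measurable (E x).
  apply: measurable_forall_fin => t; apply: measurableI; first exact: mX.
  apply: measurable_forall_fin => k; rewrite -[X in measurable X]setTI.
  exact: mZ.
rewrite measure_fin_bigcup //; last first.
  move=> x y _ _ [w [Ex Ey]]; apply/ffunP => t.
  by have [<- _] := Ex t; have [] := Ey t.
rewrite -fsbig_seq ?filter_uniq ?index_enum_uniq // /r big_filter.
rewrite -sumEFin ge0_sume_distrl; last first.
  move=> x _; rewrite lee_fin path_weight_ge0 //; first by case: hpi.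
  by move=> a b; apply: le_trans (hQ.1 a b); case/andP: s01 => /ltW.
apply: eq_bigr => x _; apply: etrans (law n x (fun _ t => B t) (fun _ t => mB t)) _.
by rewrite /noise_prob exchange_big.
Qed.

Lemma path_law (n : nat) (S : pred {ffun 'I_n.+1 -> 'I_(pK ts)}) :
  P [set w | S [ffun t : 'I_n.+1 => X t.+1 w]] =
  (\sum_(x : {ffun 'I_n.+1 -> 'I_(pK ts)} | S x) path_weight mu Q x)%:E.
Proof.
have := @joint_law n S (fun=> setT) (fun=> measurableT).
rewrite [X in (_ * X)%E]big1 ?mule1 => [<-|t _]; last exact: noise_probT.
by congr (P _); apply: eq_set => w; apply/propext; split => [|[]].
Qed.

Lemma sum_ppi_weight n : \sum_(x : {ffun 'I_n.+1 -> 'I_(pK ts)}) path_weight mu Q x = 1.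
Proof. by apply: sum_path_weight_eq1; [case: hpi|case: hQ]. Qed.

Lemma noise_law (n : nat) (B : 'I_n.+1 -> set R) : (forall t, measurable (B t)) ->
  P [set w | forall (t : 'I_n.+1) k, B t (Z k t.+1 w)] =
  (\prod_(t < n.+1) noise_prob (B t))%E.
Proof.
move=> mB; have := joint_law xpredT mB; rewrite sum_ppi_weight mul1e => <-.
by congr (P _); apply: eq_set => w; apply/propext; split => // -[].
Qed.

Lemma noise_law1 (t : nat) (B : set R) : measurable B ->
  P [set w | forall k, B (Z k t.+1 w)] = noise_prob B.
Proof.
move=> mB.
have := @noise_law t (fun u => if u == ord_max then B else setT).
have m1 (u : 'I_t.+1) : measurable (if u == ord_max then B else setT) by case: ifP.
move=> /(_ m1); rewrite (bigD1 ord_max) //= eqxx [X in (_ * X)%E]big1; last first.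
  by move=> u /negPf ->; exact: noise_probT.
rewrite mule1 => <-; congr (P _); apply/seteqP; split => w /= h.
  by move=> u k; case: eqP => // ->; exact: h.
by move=> k; have := h ord_max k; rewrite eqxx.
Qed.

Lemma noise_law2 (t u : nat) (B C : set R) : measurable B -> measurable C -> t != u ->
  P ([set w | forall k, B (Z k t.+1 w)] `&` [set w | forall k, C (Z k u.+1 w)]) =
  (noise_prob B * noise_prob C)%E.
Proof.
move=> mB mC tu; pose n := maxn t u.
have tn : (t < n.+1)%N by rewrite ltnS leq_maxl.
have un : (u < n.+1)%N by rewrite ltnS leq_maxr.
pose D (v : 'I_n.+1) := if v == Ordinal tn then B else if v == Ordinal un then C else setT.
have mD v : measurable (D v) by rewrite /D; case: ifP => // _; case: ifP.
have ut : (Ordinal un == Ordinal tn) = false.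
  by apply/negbTE; rewrite eq_sym.
have := noise_law mD.
rewrite (bigD1 (Ordinal tn)) //= (bigD1 (Ordinal un)) ?ut //= [X in (_ * (_ * X))%E]big1; last first.
  by move=> v /andP[/negPf vt /negPf vu]; rewrite /D vt vu; exact: noise_probT.
rewrite mule1 {2 3}/D eqxx ut eqxx => <-; congr (P _); apply/seteqP; split => w /=.
  move=> [hB hC] v k; rewrite /D; case: eqP => [->|_]; first exact: hB.
  by case: eqP => // ->; exact: hC.
move=> h; split=> k; first by have := h (Ordinal tn) k; rewrite /D eqxx.
by have := h (Ordinal un) k; rewrite /D ut eqxx.
Qed.

Lemma pK_gt0 : (0 < pK ts)%N.
Proof.
rewrite lt0n; apply/eqP => K0; have [_] := hpi.
rewrite big1 => [/esym/eqP|i _]; first by rewrite oner_eq0.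
by have := leq_ltn_trans (leq0n i) (ltn_ord i); rewrite [X in (_ < X)%N]K0.
Qed.

Lemma Zmax_ge0 t w : 0 <= Zmax Z t w.
Proof. exact: bigmax_ge_id. Qed.

Lemma Zmax_ge k t w : `|Z k t w| <= Zmax Z t w.
Proof. exact: le_bigmax. Qed.

Lemma measurable_Zmax t : measurable_fun setT (Zmax Z t).
Proof.
have [_ [mZ _]] := hdata.
by apply: measurable_bigmax => k; exact: measurableT_comp.
Qed.

(** Since [f] is monotone on nonnegative reals only, it is replaced by [f (max z 0)], which takes
    the same values along [Zmax]. *)
Lemma measurable_noise (f : R -> R) t :
  (forall a b, 0 <= a -> a <= b -> f a <= f b) ->
  measurable_fun setT (fun w => f (Zmax Z t w)).
Proof.
move=> fnd.
have mf : measurable_fun setT (fun z : R => f (Num.max z 0)).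
  apply: nondecreasing_measurable => // a b ab; apply: fnd.
    by rewrite le_max lexx orbT.
  by rewrite ge_max !le_max ab lexx orbT.
rewrite (_ : (fun w => _) = (fun z : R => f (Num.max z 0)) \o Zmax Z t).
  by apply: measurableT_comp => //; exact: measurable_Zmax.
by apply/funext => w /=; rewrite max_l // Zmax_ge0.
Qed.

Lemma noise_avg_le (f : R -> R) (e c : R) :
  (forall a b, 0 <= a -> a <= b -> f a <= f b) -> (forall a, 0 <= a -> 0 <= f a) ->
  (\int[P]_w (f (Zmax Z 1 w))%:E <= e%:E)%E -> 2 * e < c ->
  {ae P, forall w, exists n0 : nat, forall n : nat, (n0 <= n)%N ->
     \sum_(i < n) f (Zmax Z i.+1 w) <= c * n%:R}.
Proof.
move=> fnd f0 fe ec.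
pose B a := [set z : R | f `|z| <= a].
have mf : measurable_fun setT (fun z : R => f (Num.max z 0)).
  apply: nondecreasing_measurable => // a b ab; apply: fnd.
    by rewrite le_max lexx orbT.
  by rewrite ge_max !le_max ab lexx orbT.
have mf' : measurable_fun setT (fun z : R => f `|z|).
  rewrite (_ : (fun z => _) = (fun z : R => f (Num.max z 0)) \o Num.norm).
    by apply: measurableT_comp => //; exact: normr_measurable.
  by apply/funext => z /=; rewrite max_l.
have mB a : measurable (B a).
  by rewrite /B -preimage_itvNyc -[X in measurable X]setTI; exact: mf'.
(* Monotonicity turns a bound on [f (Zmax)] into a bound on each noise, so identical laws and
   pairwise independence follow from the noise laws by complement. *)
have VB t a : [set w | a < f (Zmax Z t.+1 w)] = ~` [set w | forall k, B a (Z k t.+1 w)].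
  apply/seteqP; split => w /=.
    move=> af Bw; suff : f (Zmax Z t.+1 w) <= a by rewrite leNgt af.
    rewrite /Zmax.
    have [k _ ->] := @eq_bigmax _ _ _ 0 (Ordinal pK_gt0) xpredT (fun k => `|Z k t.+1 w|)
      isT (fun _ _ => normr_ge0 _).
    exact: Bw.
  move=> nB; rewrite ltNge; apply/negP => fa; apply: nB => k.
  by rewrite /B /= (le_trans _ fa) // fnd // Zmax_ge.
have mBZ t a : measurable [set w | forall k, B a (Z k t.+1 w)].
  have [_ [mZ _]] := hdata; apply: measurable_forall_fin => k.
  by rewrite -[X in measurable X]setTI; exact: mZ.
apply: (@avg_le_eventually R _ _ P (fun t w => f (Zmax Z t.+1 w)) c e) => //.
- by move=> t; exact: measurable_noise.
- by move=> t w; rewrite f0 // Zmax_ge0.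
- by move=> t a; rewrite !VB !probability_setC // !noise_law1.
- move=> t u a b tu; rewrite !VB indep_setC //.
  by rewrite noise_law2 // !noise_law1.
Qed.

(** By dominated convergence some [f k] has expectation at most [eta / 4], which leaves room for the
    factor 2 of [noise_avg_le]. *)
Lemma noise_tail_avg (f : nat -> R -> R) (F : Omega -> R) (eta : R) :
  (forall k a b, 0 <= a -> a <= b -> f k a <= f k b) ->
  (forall k a, 0 <= a -> 0 <= f k a) ->
  (forall a, exists k0 : nat, forall k : nat, (k0 <= k)%N -> f k a = 0) ->
  P.-integrable setT (EFin \o F) -> (forall k w, f k (Zmax Z 1 w) <= F w) -> 0 < eta ->
  exists k, {ae P, forall w, exists n0 : nat, forall n : nat, (n0 <= n)%N ->
     \sum_(i < n) f k (Zmax Z i.+1 w) <= eta * n%:R}.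
Proof.
move=> fnd f0 fev iF fF eta0.
pose fz k w : \bar R := (f k (Zmax Z 1 w))%:E.
have mfz k : measurable_fun setT (fz k).
  by apply/measurable_EFinP; apply: measurable_noise => a b; exact: fnd.
have fz0 : {ae P, forall w, setT w -> fz ^~ w @ \oo --> 0%E}.
  apply: aeW => w _; have [k0 hk0] := fev (Zmax Z 1 w).
  apply: cvg_near_cst; near=> k; rewrite /fz hk0 //.
  by near: k; exact: nbhs_infty_ge.
have fzF : {ae P, forall w k, setT w -> (`|fz k w| <= (EFin \o F) w)%E}.
  apply: aeW => w k _; rewrite /fz /= lee_fin ger0_norm ?fF //.
  by rewrite f0 // Zmax_ge0.
have [_ _] := dominated_convergence measurableT mfz (measurable_cst _) fz0 iF fzF.
rewrite integral0 => cv.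
have [k fk] : exists k, (\int[P]_w fz k w <= (eta / 4)%:E)%E.
  apply: contrapT => /forallNP hk.
  have : ((eta / 4)%:E <= 0)%E.
    rewrite -(cvg_lim _ cv) //; apply: lime_ge; first by apply/cvg_ex; exists 0%E.
    by apply: nearW => k; rewrite ltW // ltNge; apply/negP; exact: hk.
  by rewrite lee_fin leNgt divr_gt0.
exists k; apply: noise_avg_le fk _ => [a b|a|]; [exact: fnd|exact: f0|lra].
Unshelve. all: by end_near.
Qed.

Lemma noise_tail_count (eta : R) : 0 < eta -> exists2 r0 : R, 0 <= r0 &
  {ae P, forall w, exists n0 : nat, forall n : nat, (n0 <= n)%N ->
     \sum_(i < n) ((r0 < Zmax Z i.+1 w)%R)%:R <= eta * n%:R}.
Proof.
move=> eta0.
have [||||||k hk] := @noise_tail_avg (fun k z => ((k%:R < z)%R)%:R) (cst 1) eta.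
- move=> k a b _ ab; case: (ltP _ a) => [ka|_]; last exact: ler0n.
  by rewrite (lt_le_trans ka ab).
- by move=> k a _; exact: ler0n.
- move=> a; exists (Num.bound `|a|) => k ak; case: ltP => // ka; exfalso.
  have : a < k%:R.
    rewrite (le_lt_trans (ler_norm a)) // (lt_le_trans (archi_boundP (normr_ge0 a))) //.
    by rewrite ler_nat.
  by rewrite ltNge (ltW ka).
- exact: finite_measure_integrable_cst.
- by move=> k w /=; case: ltP.
- exact: eta0.
by exists k%:R.
Qed.

(** The price, in log-likelihood, of emitting noise [z] from a trend at distance [M]; the positive
    part makes it a nonnegative function, as the averaging lemmas require. *)
Definition log_cost (m : R -> R) (M z : R) := Num.max 0 (- ln (m (M + z))).

Lemma log_cost_le m M a b : nonincr_pos m -> (forall z, 0 <= z -> 0 < m z) -> 0 <= M ->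
  0 <= a -> a <= b -> log_cost m M a <= log_cost m M b.
Proof.
move=> [mni _] m0 M0 a0 ab; rewrite /log_cost ge_max !le_max lexx /= lerN2.
rewrite ler_ln ?posrE ?m0 ?mni ?orbT ?lerD2l ?addr_ge0 //.
exact: le_trans ab.
Qed.

Lemma log_cost_ge0 m M a : 0 <= log_cost m M a.
Proof. by rewrite /log_cost le_max lexx. Qed.

Lemma expR_log_cost m M z : 0 < m (M + z) -> expR (- log_cost m M z) <= m (M + z).
Proof.
by move=> m0; rewrite -[leRHS]lnK ?posrE // ler_expR lerNl /log_cost le_max lexx orbT.
Qed.

(** Integrability of [ln m] dominates the excess of the cost over [k]; [k1] lets the threshold be
    taken as large as wished. *)
Lemma log_cost_tail (m : R -> R) (M eta : R) (k1 : nat) :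
  nonincr_pos m -> (forall z, 0 <= z -> 0 < m z) -> 0 <= M -> 0 < eta ->
  P.-integrable setT (fun w => (ln (m (M + Zmax Z 1 w)))%:E) ->
  exists2 k : nat, (k1 <= k)%N &
  {ae P, forall w, exists n0 : nat, forall n : nat, (n0 <= n)%N ->
     \sum_(i < n) Num.max 0 (log_cost m M (Zmax Z i.+1 w) - k%:R) <= eta * n%:R}.
Proof.
move=> mni m0 M0 eta0 im.
have [||||||k hk] := @noise_tail_avg
  (fun k z => Num.max 0 (log_cost m M z - (k + k1)%:R))
  (fun w => `|ln (m (M + Zmax Z 1 w))|) eta.
- move=> k a b a0 ab; rewrite ge_max !le_max lexx /=; apply/orP; right.
  by rewrite lerD2r log_cost_le.
- by move=> k a _; rewrite le_max lexx.
- move=> a; exists (Num.bound (log_cost m M a)) => k ak; rewrite max_l // subr_le0.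
  rewrite (le_trans (ltW (archi_boundP (log_cost_ge0 m M a)))) // ler_nat.
  by rewrite (leq_trans ak) // leq_addr.
- exact: integrable_abse im.
- move=> k w; rewrite ge_max normr_ge0 /= lerBlDr ge_max addr_ge0 //=.
  by rewrite ler_wpDr // -normrN ler_norm.
- exact: eta0.
by exists (k + k1)%N => //; exact: leq_addl.
Qed.

(** Only transitions are bounded below: [mu] may vanish somewhere, whereas the lower bound on the
    true likelihood contains [ln (mu (X 1 w))]. *)
Lemma ppi_gt0_ae : {ae P, forall w, 0 < mu (X 1 w)}.
Proof.
have [mX _] := hdata.
pose S (x : {ffun 'I_1 -> 'I_(pK ts)}) := mu (x ord0) <= 0.
exists [set w | S [ffun t : 'I_1 => X t.+1 w]].
split.
- rewrite (_ : [set w | _] = \bigcup_(x in [set x | mu x <= 0]) (X 1 @^-1` [set x])).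
    by apply: fin_bigcup_measurable => // x _; exact: mX.
  apply/seteqP; split => [w|w [x /= mx Xw]]; rewrite /S /= ffunE.
    by move=> h; exists (X 1 w).
  by rewrite Xw.
- rewrite path_law big1 // => x Sx; rewrite /path_weight.
  have -> : mu (x ord0) = 0 by apply/eqP; rewrite eq_le [X in X && _]Sx; case: hpi => ->.
  by rewrite mul0r.
move=> w /= /negP; rewrite -leNgt => h.
by rewrite /S ffunE.
Qed.

(** Chernoff bound and Borel-Cantelli. The Laplace transform at -1 of the number of visits to [x] is
    a forward sum whose emission is [expR (-1)] at [x] and 1 elsewhere; each transition contributes
    at most [rho]. *)
Lemma state_freq : exists2 c : R, 0 < c & forall x : 'I_(pK ts),
  {ae P, forall w, exists n0 : nat, forall n : nat, (n0 <= n)%N ->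
     c * n%:R <= \sum_(i < n) (X i.+1 w == x)%:R}.
Proof.
have [s0 s1] := andP s01.
have [mu0 mu1] := hpi; have [Qs Q1] := hQ.
have Q0 a b : 0 <= Q a b by apply: le_trans (Qs a b); exact: ltW.
pose th : R := expR (-1).
have th0 : 0 < th by exact: expR_gt0.
have th1 : th < 1 by rewrite -expR0 ltr_expR ltrN10.
pose rho : R := 1 - s * (1 - th).
have rho0 : 0 < rho by rewrite /rho; nra.
have rho1 : rho < 1 by rewrite /rho; nra.
(* Half of the exponential rate: [expR (c * n) * rho ^+ n] is then [expR (- c) ^+ n], still
   summable. *)
pose c : R := - ln rho / 2.
have c0 : 0 < c by rewrite divr_gt0 // oppr_gt0 ln_lt0 // rho0.
have rhoE : rho = expR (- c) * expR (- c).
  by rewrite -expRD /c (_ : _ + _ = ln rho) ?lnK //; field.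
exists c => // x.
pose N n (y : {ffun 'I_n.+1 -> 'I_(pK ts)}) : R := \sum_(i < n.+1) (y i == x)%:R.
pose S n (y : {ffun 'I_n.+1 -> 'I_(pK ts)}) := N n y < c * n.+1%:R.
pose phi (i : nat) (a : 'I_(pK ts)) : R := if a == x then th else 1.
have phi0 i a : 0 <= phi i a by rewrite /phi; case: ifP => // _; exact: ltW.
have phi1 i a : phi i a <= 1 by rewrite /phi; case: ifP => // _; exact: ltW.
have phiE n (y : {ffun 'I_n.+1 -> 'I_(pK ts)}) : \prod_(i < n.+1) phi i (y i) = expR (- N n y).
  rewrite /N -sumrN expR_sum; apply: eq_bigr => i _; rewrite /phi.
  by case: ifP => _; rewrite ?oppr0 ?expR0.
have wS n : \sum_(y : {ffun 'I_n.+1 -> 'I_(pK ts)} | S n y) path_weight mu Q y <=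
    rho^-1 * expR (- c) ^+ n.+1.
  apply: le_trans (_ : expR (c * n.+1%:R) *
     \sum_(y : {ffun 'I_n.+1 -> 'I_(pK ts)}) path_weight mu Q y * \prod_(i < n.+1) phi i (y i) <= _).
    rewrite big_mkcond mulr_sumr; apply: ler_sum => y _.
    have w0 := path_weight_ge0 y mu0 Q0.
    rewrite phiE mulrCA -expRD; case: ifP => [Sy|_]; last by rewrite mulr_ge0 ?expR_ge0.
    by rewrite ler_peMr // -[leLHS]expR0 ler_expR subr_ge0 ltW.
  rewrite sum_path_weight.
  (* The first factor is 1 since the initial law has no lower bound; later, [x] is reached from any
     state with probability at least [s]. *)
  apply: le_trans (_ : expR (c * n.+1%:R) * \prod_(i < n.+1) (if i == 0%N :> nat then 1 else rho) <= _).
    rewrite ler_wpM2l ?expR_ge0 //.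
    apply: (@sum_fwd_le R _ mu Q phi (fun i => if i == 0%N then 1 else rho)) => //.
    - by move=> i; case: ifP => // _; exact: ltW.
    - by rewrite /= -mu1; apply: ler_sum => a _; rewrite ler_piMr.
    move=> i b /=.
    have -> : \sum_a Q b a * phi i.+1 a = 1 - Q b x * (1 - th).
      rewrite -[X in _ = X - _](Q1 b) (bigD1 x) //= [in RHS](bigD1 x) //= /phi eqxx.
      rewrite (eq_bigr (fun a => Q b a)); first by ring.
      by move=> a /negPf ->; rewrite mulr1.
    rewrite /rho lerD2l lerN2 ler_wpM2r // subr_ge0; exact: ltW.
  rewrite big_ord_recl /= mul1r.
  under eq_bigr do rewrite /=.
  rewrite prodr_const card_ord.
  have -> : rho ^+ n = rho^-1 * rho ^+ n.+1 by rewrite exprS mulKf // gt_eqF.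
  rewrite mulrCA ler_pM2l ?invr_gt0 //.
  rewrite [X in _ * X ^+ _]rhoE exprMn mulrA -[X in _ <= X]mul1r ler_wpM2r ?exprn_ge0 ?expR_ge0 //.
  by rewrite -expRM_natl -expRD (_ : _ + _ = 0) ?expR0 //; ring.
pose E n := [set w | \sum_(i < n.+1) (X i.+1 w == x)%:R < c * n.+1%:R].
have EE n : E n = [set w | S n [ffun t : 'I_n.+1 => X t.+1 w]].
  by apply: eq_set => w; rewrite /S /N; under [in RHS]eq_bigr do rewrite ffunE.
have [mX _] := hdata.
have mE n : measurable (E n).
  have mN : measurable_fun setT (fun w => \sum_(i < n.+1) (X i.+1 w == x)%:R : R).
    apply: measurable_sum => i.
    rewrite (_ : (fun w => _) = \1_(X i.+1 @^-1` [set x])); first exact: measurable_indic.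
    apply/funext => w; rewrite indicE (_ : (w \in _) = (X i.+1 w == x)) //.
    by apply/idP/eqP; rewrite inE.
  by rewrite /E -preimage_itvNyo -[X in measurable X]setTI; exact: mN.
pose C := rho^-1 * (1 - expR (- c))^-1.
have ec1 : expR (- c) < 1 by rewrite -expR0 ltr_expR oppr_lt0.
have := @borel_cantelli_eventually R _ _ P E C mE.
have PEC n : (\sum_(0 <= k < n) P (E k) <= C%:E)%E.
  apply: le_trans (_ : (\sum_(k < n) (rho^-1 * expR (- c) ^+ k.+1))%:E <= _)%E.
    rewrite big_mkord -sumEFin; apply: lee_sum => k _; rewrite EE path_law lee_fin.
    exact: wS.
  rewrite lee_fin -mulr_sumr ler_pM2l ?invr_gt0 //.
  rewrite -div1r ler_pdivlMr ?subr_gt0 //.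
  set y := expR (- c); have y0 : 0 <= y by exact: expR_ge0.
  have -> : (\sum_(k < n) y ^+ k.+1) * (1 - y) = y - y ^+ n.+1.
    elim: n => [|n IH]; first by rewrite big_ord0 mul0r expr1 subrr.
    by rewrite big_ord_recr /= mulrDl IH !exprS; ring.
  by rewrite (le_trans _ (ltW ec1)) // lerBlDr lerDl exprn_ge0.
move=> /(_ PEC); apply: filterS => w [k0 hk]; exists k0.+1 => -[//|n] kn.
by have /negP := hk n kn; rewrite -leNgt.
Qed.

End data.

(** * Likelihood bounds *)

Section likelihood.
Context (R : realType).
Implicit Types (th : param R) (Y : nat -> R).

(** Index [i] stands for time [i.+1], so that [likelihood th Y m] involves [m.+1] observations. *)
Definition emission th Y (i : nat) (a : 'I_(pK th)) : R :=
  pgam a (Y i.+1 - (pT a).[i.+1%:R]).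

Definition likelihood th Y (m : nat) : R :=
  \sum_a fwd (@ppi R th) (@pQ R th) (emission Y) m a.

Lemma loglikE th Y m : loglik th Y m.+1 = ln (likelihood th Y m).
Proof. by rewrite /likelihood -sum_path_weight. Qed.

Section bounds.
Variables (th : param R) (Y : nat -> R) (s : R).
Hypotheses (s0 : 0 < s) (hpi : prob_vector (@ppi R th)) (hQ : stoch_lb s (@pQ R th))
  (emis_gt0 : forall i (a : 'I_(pK th)), 0 < emission Y i a).

Let Q0 a b : 0 <= @pQ R th a b.
Proof. by apply: le_trans (hQ.1 a b); exact: ltW. Qed.

(** A single path is kept, and each of its [m] transitions is bounded below by [s]. *)
Lemma likelihood_ge m (x : nat -> 'I_(pK th)) :
  ppi (x 0%N) * s ^+ m * \prod_(i < m.+1) emission Y i (x i) <= likelihood th Y m.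
Proof.
rewrite /likelihood -sum_path_weight (bigD1 [ffun i : 'I_m.+1 => x i]) //=.
rewrite ler_wpDr //.
  rewrite sumr_ge0 // => y _; rewrite mulr_ge0 ?path_weight_ge0 //; first by case: hpi.
  by rewrite prodr_ge0 // => i _; exact: ltW.
under [in leRHS]eq_bigr do rewrite ffunE.
rewrite ler_wpM2r ?prodr_ge0 // => [i _|]; first exact: ltW.
rewrite /path_weight ffunE ler_wpM2l //; first by case: hpi.
rewrite -[X in s ^+ X]card_ord -prodr_const; apply: ler_prod => i _.
by rewrite ltW //= hQ.1.
Qed.

Lemma likelihood_gt0 m : 0 < likelihood th Y m.
Proof.
have [mu0 mu1] := hpi.
have [a mua] : exists a, 0 < @ppi R th a.
  apply: contrapT => /forallNP h; have := oner_neq0 R; rewrite -mu1 big1 ?eqxx // => a _.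
  by apply/eqP; rewrite eq_le mu0 andbT leNgt; exact/negP.
apply: lt_le_trans (likelihood_ge m (fun=> a)).
by rewrite !mulr_gt0 ?exprn_gt0 // prodr_gt0.
Qed.

Lemma loglik_ge m (x : nat -> 'I_(pK th)) (v : nat -> R) : 0 < ppi (x 0%N) ->
  (forall i, expR (- v i) <= emission Y i (x i)) ->
  ln (ppi (x 0%N)) + m%:R * ln s - \sum_(i < m.+1) v i <= loglik th Y m.+1.
Proof.
move=> mu0 ve; rewrite loglikE.
have -> : ln (ppi (x 0%N)) + m%:R * ln s - \sum_(i < m.+1) v i =
    ln (ppi (x 0%N) * s ^+ m * expR (- \sum_(i < m.+1) v i)).
  rewrite !lnM ?posrE ?mulr_gt0 ?exprn_gt0 ?expR_gt0 // expRK lnXn //.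
  by rewrite mulr_natl.
rewrite ler_ln ?posrE ?mulr_gt0 ?exprn_gt0 ?expR_gt0 ?likelihood_gt0 //.
apply: le_trans (likelihood_ge m x).
rewrite ler_pM2l ?mulr_gt0 ?exprn_gt0 // -sumrN expR_sum.
by apply: ler_prod => i _; rewrite expR_ge0 ve.
Qed.

Lemma loglik_le m (good : pred nat) (G e : R) : 0 < e ->
  0 < G -> (forall i (a : 'I_(pK th)), emission Y i a <= G) ->
  (forall i (a : 'I_(pK th)), good i -> emission Y i a <= e) ->
  loglik th Y m.+1 <=
    m.+1%:R * ln G + (\sum_(i < m.+1) (good i)%:R) * (ln e - ln G).
Proof.
move=> e0 G0 eG ee; rewrite loglikE.
pose B i := if good i then e else G.
have B0 i : 0 < B i by rewrite /B; case: ifP.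
have -> : m.+1%:R * ln G + (\sum_(i < m.+1) (good i)%:R) * (ln e - ln G) =
    ln (\prod_(i < m.+1) B i).
  have -> : \prod_(i < m.+1) B i = expR (\sum_(i < m.+1) ln (B i)).
    by rewrite expR_sum; apply: eq_bigr => i _; rewrite lnK ?posrE.
  rewrite expRK mulr_suml -[X in X%:R * _](card_ord m.+1) mulr_natl -sumr_const -big_split /=.
  by apply: eq_bigr => i _; rewrite /B; case: ifP => _ /=; ring.
rewrite ler_ln ?posrE ?likelihood_gt0 ?prodr_gt0 //.
have eB i (a : 'I_(pK th)) : emission Y i a <= B i.
  by rewrite /B; case: ifP => // gi; exact: ee.
have [mu0 mu1] := hpi.
apply: sum_fwd_le => //.
- by move=> i a; exact: ltW.
- by move=> i; exact: ltW.
- rewrite -[leRHS]mul1r -mu1 mulr_suml; apply: ler_sum => a _.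
  by rewrite ler_wpM2l.
move=> i b; rewrite -[leRHS]mul1r -(hQ.2 b) mulr_suml; apply: ler_sum => a _.
by rewrite ler_wpM2l.
Qed.

End bounds.

Lemma loglik_delete_state (K d : nat) (s : R) (Gam : set (R -> R)) (k : nat)
    (mu : 'I_k.+1 -> R) (Q : 'I_k.+1 -> 'I_k.+1 -> R) (gam : 'I_k.+1 -> R -> R)
    (T : 'I_k.+1 -> {poly R}) (x0 : 'I_k.+1) (Y : nat -> R) (c : nat -> 'I_k)
    (rho : nat -> R) (m : nat) :
  let th := Param mu Q gam T in
  0 < s < 1 -> in_Theta K d s Gam th ->
  (forall gam, Gam gam -> forall z, 0 < gam z) ->
  (forall i, 0 <= rho i) ->
  (forall i, @emission th Y i x0 <= rho i * @emission th Y i (lift x0 (c i))) ->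
  exists2 th', in_Theta K d s Gam th' &
    loglik th Y m.+1 <= ln (k%:R / (1 - s)) + m.+1%:R * ln (1 - s) +
      \sum_(i < m.+1) ln (1 + rho i / (s * (1 - s)) ^+ 2) + loglik th' Y m.+1.
Proof.
move=> th s01 [/andP[_ /= kK] [mu0 mu1] [Qs Q1] hgam hT] g0 rho0 hrho.
have /andP[s0 s1] := s01.
have s1' : 0 < 1 - s by rewrite subr_gt0.
have k0 : (0 < k)%N by exact: leq_ltn_trans (leq0n _) (ltn_ord (c 0%N)).
have kR : 0 < k%:R :> R by rewrite ltr0n.
have Q0 a b : 0 <= Q a b by apply: le_trans (Qs a b); exact: ltW.
have mule1 a : mu a <= 1.
  by rewrite -mu1 (bigD1 a) //= lerDl sumr_ge0.
have Qle1 a b : Q a b <= 1.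
  by rewrite -(Q1 a) (bigD1 b) //= lerDl sumr_ge0.
(* The lower bound uses a second state, provided by [c]; the upper bound is the source of the gain
   [1 - s] per step. *)
have Qx a : s <= 1 - Q a x0 <= 1 - s.
  have h : s <= \sum_(b | b != x0) Q a b.
    rewrite (bigD1 (lift x0 (c 0%N))) /=; last by rewrite eq_sym neq_lift.
    by rewrite ler_wpDr // sumr_ge0.
  by have := Q1 a; rewrite (bigD1 x0) //=; have := Qs a x0; lra.
have Qx0 a : 0 < 1 - Q a x0 by have /andP[h _] := Qx a; exact: lt_le_trans h.
(* The chain conditioned to avoid [x0]; normalising only raises the entries, which stay at least
   [s]. *)
pose Q' (a b : 'I_k) := Q (lift x0 a) (lift x0 b) / (1 - Q (lift x0 a) x0).
have Q's a b : s <= Q' a b.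
  rewrite ler_pdivlMr //; apply: le_trans (Qs (lift x0 a) (lift x0 b)).
  by rewrite ler_piMr ?(ltW s0) // gerBl.
have QQ' a b : Q (lift x0 a) (lift x0 b) <= (1 - s) * Q' a b.
  rewrite /Q' mulrA ler_pdivlMr // mulrC ler_wpM2r //.
  by have /andP[] := Qx (lift x0 a).
pose th' := @Param R k (fun=> k%:R^-1) Q' (fun a => gam (lift x0 a)) (fun a => T (lift x0 a)).
have th'T : in_Theta K d s Gam th'.
  split => //=.
  - by rewrite k0 ltnW.
  - split => [i|]; first by rewrite invr_ge0.
    by rewrite sumr_const card_ord -[_ *+ _]mulr_natr mulVf // gt_eqF.
  split => // a; rewrite /Q' -mulr_suml.
  have := Q1 (lift x0 a); rewrite (bigD1_ord x0) //= => h.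
  have -> : \sum_(b < k) Q (lift x0 a) (lift x0 b) = 1 - Q (lift x0 a) x0 by lra.
  by rewrite divff // gt_eqF.
exists th' => //.
have e0 i a : 0 < @emission th Y i a by exact: g0.
have e0' i a : 0 < @emission th' Y i a by apply: g0; exact: hgam.
have L0 : 0 < likelihood th Y m by apply: (@likelihood_gt0 th Y s).
have L0' : 0 < likelihood th' Y m.
  by apply: (@likelihood_gt0 th' Y s) => //; case: th'T.
(* The factor of [fwd_delete_state] with [1 - s] taken out. *)
pose h i := 1 + rho i / (s * (1 - s)) ^+ 2.
have h0 i : 0 < h i.
  by rewrite ltr_pwDl // divr_ge0 // exprn_ge0 // mulr_ge0 // ltW.
have -> : ln (k%:R / (1 - s)) + m.+1%:R * ln (1 - s) +
      \sum_(i < m.+1) ln (1 + rho i / (s * (1 - s)) ^+ 2) + loglik th' Y m.+1 =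
    ln (k%:R / (1 - s) * ((1 - s) ^+ m.+1 * \prod_(i < m.+1) h i) * likelihood th' Y m).
  have -> : \prod_(i < m.+1) h i = expR (\sum_(i < m.+1) ln (h i)).
    by rewrite expR_sum; apply: eq_bigr => i _; rewrite lnK ?posrE.
  have lnM4 (x y z t : R) : 0 < x -> 0 < y -> 0 < z -> 0 < t ->
      ln (x * (y * z) * t) = ln x + ln y + ln z + ln t.
    by move=> *; rewrite !lnM ?posrE ?mulr_gt0 // addrA.
  rewrite lnM4 ?exprn_gt0 ?expR_gt0 ?divr_gt0 //.
  by rewrite expRK lnXn // [m.+1%:R * _]mulr_natl loglikE.
rewrite [leLHS](_ : _ = ln (likelihood th Y m)); last exact: (loglikE th Y m).
rewrite ler_ln ?posrE //; last first.
  by rewrite !mulr_gt0 ?exprn_gt0 ?divr_gt0 ?prodr_gt0 ?invr_gt0.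
have := @fwd_delete_state R k x0 s mu Q (@emission th Y) Q' c rho m s01.
have m01 a : 0 <= mu a <= 1 by rewrite mu0 mule1.
have Q01 a b : 0 <= Q a b <= 1 by rewrite Q0 Qle1.
have eg i a : 0 <= @emission th Y i a by exact: ltW.
move=> /(_ m01 Q01 Q's QQ' eg rho0 hrho) => /le_trans; apply.
rewrite -[X in _ ^+ X](card_ord m.+1) -prodr_const -big_split /= ler_wpM2r //.
  exact: ltW.
rewrite le_eqVlt; apply/orP; left; apply/eqP; congr (_ * _); apply: eq_bigr => i _.
by rewrite /h; field; rewrite !gt_eqF.
Qed.

End likelihood.

(** * Localization *)

(** The counting lemma applied to [p - q]: two trends that separate somewhere on [[0, n]] are within
    [D] of each other at few integer times. *)
Lemma count_not_sup_close (R : realType) (d n : nat) (p q : {poly R}) (D dl M : R) :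
  (size p <= d.+1)%N -> (size q <= d.+1)%N -> 0 <= D -> 0 < dl ->
  d.+1%:R <= dl * n%:R -> D * (1 + 2 * (2 * d.+1%:R / dl)) ^+ d <= M ->
  ~ sup_close n M p q ->
  \sum_(i < n) ((`|p.[i.+1%:R] - q.[i.+1%:R]| <= D)%R)%:R <= dl * n%:R :> R.
Proof.
move=> sp sq D0 dl0 dn DM nclose.
have spq : (size (p - q)%R <= d.+1)%N.
  by rewrite (leq_trans (size_polyD _ _)) // geq_max sp size_polyN.
have := @count_poly_small R d n (p - q) D dl spq D0 dl0 dn.
under eq_bigr do rewrite hornerD hornerN.
apply; move: nclose => /existsNP[x /not_implyP[xn /negP]]; rewrite -ltNge => h.
by exists x => //; rewrite (le_lt_trans DM) // hornerD hornerN.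
Qed.

Lemma eventually_natr_gt (R : realType) (x : R) :
  exists n0 : nat, forall n : nat, (n0 <= n)%N -> x < n%:R.
Proof.
exists (Num.bound `|x|) => n n0.
rewrite (le_lt_trans (ler_norm x)) // (lt_le_trans (archi_boundP (normr_ge0 x))) //.
by rewrite ler_nat.
Qed.

(* Splitting according to [V <= 2 k] or not: beyond [2 k] the excess [V - k] controls [V]. *)
Lemma ln_penalty_le (R : realType) (A G e V k : R) (exc : bool) :
  0 <= A -> 0 <= e -> e <= G -> 0 <= V -> ln (1 + A * G) <= 2 * k ->
  ln (1 + A * ((if exc then G else e) * expR V)) <=
    A * e * expR (2 * k) + (ln (1 + A * G) + 2 * k) * exc%:R + 4 * Num.max 0 (V - k).
Proof.
move=> A0 e0 eG V0; set c0 := ln (1 + A * G) => c0k.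
have G0 : 0 <= G := le_trans e0 eG.
have AG0 : 0 <= A * G by rewrite mulr_ge0.
have c00 : 0 <= c0 by rewrite ln_ge0 // lerDl.
have k0 : 0 <= k by lra.
have [Gi GiE] : exists Gi, Gi = if exc then G else e by eexists.
rewrite -GiE.
have Gi0 : 0 <= Gi by rewrite GiE; case: ifP.
have GiG : Gi <= G by rewrite GiE; case: ifP.
have eV1 : 1 <= expR V by rewrite -[leLHS]expR0 ler_expR.
have up : ln (1 + A * (Gi * expR V)) <= c0 + V.
  rewrite /c0 -[V in leRHS]expRK -lnM ?posrE ?expR_gt0 ?ltr_pwDl //.
  rewrite ler_ln ?posrE ?mulr_gt0 ?expR_gt0 ?ltr_pwDl ?mulr_ge0 ?expR_ge0 //.
  rewrite mulrDl mul1r lerD // mulrA ler_wpM2r ?expR_ge0 // ler_wpM2l //.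
have ae0 : 0 <= A * e * expR (2 * k) by rewrite !mulr_ge0 ?expR_ge0.
have mx0 : 0 <= Num.max 0 (V - k) by rewrite le_max lexx.
have mxV : V - k <= Num.max 0 (V - k) by rewrite le_max lexx orbT.
have ex0 : 0 <= (c0 + 2 * k) * exc%:R by rewrite mulr_ge0 ?addr_ge0 ?mulr_ge0.
(* Beyond [2 * k], the bound [c0 + V <= 2 * V <= 4 * (V - k)] explains the constant 4. *)
case: (leP V (2 * k)) => Vk; last by lra.
case: exc GiE ex0 => /= GiE ex0; first by rewrite mulr1; lra.
rewrite GiE; suff : ln (1 + A * (e * expR V)) <= A * e * expR (2 * k) by lra.
apply: le_trans (_ : A * (e * expR V) <= _).
  by apply: le_ln1Dx; rewrite (lt_le_trans (ltrN10 R)) // !mulr_ge0 ?expR_ge0.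
by rewrite mulrA ler_wpM2l ?mulr_ge0 // ler_expR.
Qed.

Section localization.
Context (R : realType) (K d : nat) (s : R) (Gam : set {ptws R -> R})
  (d0 : measure_display) (Omega : measurableType d0) (P : probability Omega R)
  (ts : param R) (X : nat -> Omega -> 'I_(pK ts)) (Z : 'I_(pK ts) -> nat -> Omega -> R)
  (thhat : nat -> Omega -> param R) (g m : R -> R).
Hypotheses (s01 : 0 < s < 1) (hdens : forall gam, Gam gam -> is_density gam)
  (hts : in_Theta K d s Gam ts) (hdata : data_model P X Z)
  (gni : nonincr_pos g) (gcv : (g z @[z --> +oo]) --> (0 : R))
  (gub : forall gam, Gam gam -> forall z, gam z <= g `|z|)
  (mmin : Amin Gam m)
  (mint : forall M : R, 0 < M ->
       P.-integrable setT (fun w => (ln (m (M + Zmax Z 1 w)))%:E))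
  (hmax : forall n w, in_Theta K d s Gam (thhat n w) /\
     forall th, in_Theta K d s Gam th ->
       (n%:R)^-1 * loglik th (obs X Z w) n <= (n%:R)^-1 * loglik (thhat n w) (obs X Z w) n).

Let hpi : prob_vector (@ppi R ts). Proof. by case: hts. Qed.
Let hQ : stoch_lb s (@pQ R ts). Proof. by case: hts. Qed.
Let hgamT (x : 'I_(pK ts)) : Gam (pgam x). Proof. by case: hts. Qed.
Let hg (x : 'I_(pK ts)) : is_density (pgam x). Proof. exact: hdens. Qed.
Let x1 : 'I_(pK ts) := Ordinal (pK_gt0 hpi).

Let s0 : 0 < s. Proof. by case/andP: s01. Qed.
Let s1 : 0 < 1 - s. Proof. by rewrite subr_gt0; case/andP: s01. Qed.

Let m_gt0 z : 0 <= z -> 0 < m z.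
Proof.
by move=> z0; have [_ /(_ _ (hgamT x1) z) [_]] := mmin; rewrite ger0_norm.
Qed.

Let gam_gt0 gam : Gam gam -> forall z, 0 < gam z.
Proof. by move=> hgam z; have [_ /(_ _ hgam z) [h1 h2]] := mmin; exact: lt_le_trans h1. Qed.

Let gam_ge gam : Gam gam -> forall z b, `|z| <= b -> m b <= gam z.
Proof.
move=> hgam z b zb; have [[mni _] /(_ _ hgam z) [h1 _]] := mmin.
by apply: le_trans h1; apply: mni.
Qed.

Let g_gt0 z : 0 <= z -> 0 < g z.
Proof.
move=> z0; have := gub (hgamT x1) z; rewrite ger0_norm //.
by apply: lt_le_trans; exact: gam_gt0.
Qed.

Let g_small (e r : R) : 0 < e -> exists2 D, 0 <= D & r <= D / 2 /\ g (D / 2) <= e.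
Proof.
move=> e0; have [_ g0] := gni.
have /cvgrPdist_lt /(_ e e0) [A [_ hA]] := gcv.
pose B := Num.max (Num.max r 0) (A + 1).
have rB : r <= B by rewrite !le_max lexx.
have B0 : 0 <= B by rewrite !le_max lexx orbT.
have AB : A < B by rewrite lt_max ltrDl ltr01 orbT.
exists (2 * B); first by rewrite mulr_ge0.
have -> : 2 * B / 2 = B by field.
split => //; have := hA B AB; rewrite sub0r normrN ger0_norm ?g0 //.
exact: ltW.
Qed.

Let obs_sub (x : 'I_(pK ts)) (w : Omega) t (q : {poly R}) : X t w = x ->
  obs X Z w t - q.[t%:R] = Z x t w + ((pT x).[t%:R] - q.[t%:R]).
Proof. by rewrite /obs => ->; rewrite addrA. Qed.

Let loglik_max n w th : in_Theta K d s Gam th ->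
  loglik th (obs X Z w) n.+1 <= loglik (thhat n.+1 w) (obs X Z w) n.+1.
Proof. by move=> /(hmax n.+1 w).2; rewrite ler_pM2l // invr_gt0. Qed.

(** Noise of size at most [D / 2] cannot bridge a gap of more than [D] between trends: the residual
    still exceeds [D / 2]. *)
Let far_emission th (a : 'I_(pK th)) (w : Omega) i (D : R) :
  Gam (pgam a) -> Zmax Z i.+1 w <= D / 2 ->
  D < `|(pT (X i.+1 w)).[i.+1%:R] - (pT a).[i.+1%:R]| ->
  0 <= D ->
  emission (obs X Z w) i a <= g (D / 2).
Proof.
move=> ga ZD far D0; have [gn _] := gni.
rewrite /emission (obs_sub _ (erefl (X i.+1 w))).
set u := _ - _ in far *; set z := Z _ _ _.
have zD : `|z| <= D / 2 by apply: le_trans ZD; exact: Zmax_ge.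
apply: le_trans (gub ga _) _; apply: gn; first by rewrite divr_ge0.
have := ler_normB (z + u) z; rewrite addrAC subrr add0r; lra.
Qed.

Let emission_le th (a : 'I_(pK th)) Y i : Gam (pgam a) -> emission Y i a <= g 0.
Proof. by move=> ga; apply: le_trans (gub ga _) _; apply: gni.1. Qed.

Lemma true_states_covered : exists2 M : R, 0 < M &
  {ae P, forall w, exists n0 : nat, forall n : nat, (n0 <= n)%N ->
    forall xs : 'I_(pK ts), exists x : 'I_(pK (thhat n w)),
      sup_close n M (pT xs) (pT x)}.
Proof.
have K0 : 0 < K%:R :> R by rewrite ltr0n; have [/andP[h1 h2] _ _ _ _] := hts; exact: leq_trans h2.
have [c c0 hfreq] := state_freq s01 hpi hQ hg hdata.
have [mni _] := mmin.
(* At the true state the residual is pure noise; distance 1 is used because (Aint) concerns positive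
   distances. *)
have [k _ hk] := log_cost_tail s01 hpi hQ hg hdata 0 mni m_gt0 ler01 ltr01 (mint ltr01).
have [r0 r00 hr0] := noise_tail_count s01 hpi hQ hg hdata (divr_gt0 c0 (ltr0n R 4)).
set G := g 0; have G0 : 0 < G by exact: g_gt0.
(* Loss per observation required of the fit: the gap between the ceiling [ln G] and the floor
   [ln s - (k + 1)] of the truth, plus 1 to beat the initial term. It is spread over at least
   [c / 2 * n] good times, whence [tau]. *)
pose B := `|ln G - ln s + k%:R + 1 + 1|.
pose tau := 2 / c * B.
have tau0 : 0 <= tau by apply: mulr_ge0; [apply: divr_ge0 => //; exact: ltW|exact: normr_ge0].
have [D D0 [rD gD]] := g_small r0 (mulr_gt0 G0 (expR_gt0 (- tau))).
have e0 : 0 < g (D / 2) by apply: g_gt0; rewrite divr_ge0.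
have eG : ln (g (D / 2)) - ln G <= - tau.
  have := gD; rewrite -ler_ln ?posrE ?mulr_gt0 ?expR_gt0 // lnM ?posrE ?expR_gt0 // expRK.
  by rewrite lerBlDl.
(* With at most [K] fitted trends, the times at which one of them is within [D] number at most
   [c / 4 * n]. *)
pose dl := c / (4 * K%:R).
have dl0 : 0 < dl by rewrite divr_gt0 // mulr_gt0.
pose M := D * (1 + 2 * (2 * d.+1%:R / dl)) ^+ d + 1.
have M0 : 0 < M.
  have q0 : 0 <= 2 * d.+1%:R / dl by apply: divr_ge0; [exact: mulr_ge0|exact: ltW].
  by rewrite ltr_wpDl // mulr_ge0 // exprn_ge0 // addr_ge0 // mulr_ge0.
exists M => //.
have hfreq' : {ae P, forall w, exists n0 : nat, forall n : nat, (n0 <= n)%N ->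
    forall x, c * n%:R <= \sum_(i < n) (X i.+1 w == x)%:R}.
  have : {ae P, forall w x, exists n0 : nat, forall n : nat, (n0 <= n)%N ->
      c * n%:R <= \sum_(i < n) (X i.+1 w == x)%:R} by exact: filter_forall hfreq.
  apply: filterS => w /choice[n0 hn0]; exists (\max_x n0 x)%N => n hn x.
  by apply: hn0; apply: leq_trans hn; exact: leq_bigmax.
near=> w.
have [n1 hn1] : exists n0 : nat, forall n : nat, (n0 <= n)%N ->
    forall x, c * n%:R <= \sum_(i < n) (X i.+1 w == x)%:R by near: w.
have [n2 hn2] : exists n0 : nat, forall n : nat, (n0 <= n)%N ->
   \sum_(i < n) Num.max 0 (log_cost m 1 (Zmax Z i.+1 w) - k%:R) <= 1 * n%:R by near: w.
have [n3 hn3] : exists n0 : nat, forall n : nat, (n0 <= n)%N ->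
   \sum_(i < n) ((r0 < Zmax Z i.+1 w)%R)%:R <= c / 4 * n%:R by near: w.
have mu0 : 0 < ppi (X 1%N w) by near: w; exact: (ppi_gt0_ae s01 hpi hQ hg hdata).
have [n4 hn4] := eventually_natr_gt (d.+1%:R / dl).
have [n5 hn5] := eventually_natr_gt (ln s - ln (ppi (X 1%N w))).
exists (maxn (maxn n1 n2) (maxn n3 (maxn n4 (maxn n5 1)))) => n.
rewrite !geq_max => /andP[/andP[/hn1 {}hn1 /hn2 {}hn2] /andP[/hn3 {}hn3]].
move=> /andP[/hn4 {}hn4 /andP[/hn5 {}hn5 n0]] xs.
apply: contrapT => /forallNP nclose.
case: n n0 => // n _ in hn1 hn2 hn3 hn4 hn5 nclose *.
set th := thhat n.+1 w in nclose *.
have [thT _] := hmax n.+1 w; rewrite -/th in thT.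
have [/andP[thK0 thK] thpi thQ thg thd] := thT.
have [_ _ _ _ tsd] := hts.
pose far i := [forall x : 'I_(pK th), D < `|(pT xs).[i.+1%:R] - (pT x).[i.+1%:R]|].
pose good i := [&& X i.+1 w == xs, Zmax Z i.+1 w <= D / 2 & far i].
have up : loglik th (obs X Z w) n.+1 <=
    n.+1%:R * ln G + (\sum_(i < n.+1) (good i)%:R) * (ln (g (D / 2)) - ln G).
  apply: (@loglik_le R th (obs X Z w) s) => //.
  - by move=> i a; apply: gam_gt0.
  - by move=> i a; exact: emission_le.
  by move=> i a /and3P[/eqP Xxs ZD /forallP /(_ a)]; rewrite -Xxs => fa; apply: far_emission.
have lo : ln (ppi (X 1%N w)) + n%:R * ln s - \sum_(i < n.+1) log_cost m 1 (Zmax Z i.+1 w)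
    <= loglik ts (obs X Z w) n.+1.
  apply: (@loglik_ge R ts (obs X Z w) s s0 hpi hQ _ n (fun i => X i.+1 w)
    (fun i => log_cost m 1 (Zmax Z i.+1 w))) => //.
  - by move=> i a; apply: gam_gt0.
  move=> i; rewrite /emission (obs_sub _ (erefl _)) subrr addr0.
  apply: le_trans (expR_log_cost _) (gam_ge (hgamT _) _).
    by rewrite m_gt0 // addr_ge0 // Zmax_ge0.
  by rewrite ler_wpDl // Zmax_ge.
have le := loglik_max n w hts.
have ngood : c / 2 * n.+1%:R <= \sum_(i < n.+1) (good i)%:R.
  have hx (x : 'I_(pK th)) : \sum_(i < n.+1)
      ((`|(pT xs).[i.+1%:R] - (pT x).[i.+1%:R]| <= D)%R)%:R <= dl * n.+1%:R :> R.
    apply: (@count_not_sup_close R d n.+1 _ _ D dl M) => //.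
      by rewrite mulrC -ler_pdivrMr // ltW.
    by rewrite /M lerDl.
  (* A visit to [xs] is good, noisy, or close to a fitted trend; the last two kinds take at most
     [c / 4 * n] each from the [c * n] visits. *)
  have : \sum_(i < n.+1) (X i.+1 w == xs)%:R <=
      \sum_(i < n.+1) ((good i)%:R + ((r0 < Zmax Z i.+1 w)%R)%:R +
        \sum_(x : 'I_(pK th)) ((`|(pT xs).[i.+1%:R] - (pT x).[i.+1%:R]| <= D)%R)%:R) :> R.
    apply: ler_sum => i _; rewrite /good.
    have S0 : 0 <= \sum_(x : 'I_(pK th)) ((`|(pT xs).[i.+1%:R] - (pT x).[i.+1%:R]| <= D)%R)%:R :> R.
      by rewrite sumr_ge0.
    case: eqP => /= _; last by rewrite !addr_ge0.
    case: (leP (Zmax Z i.+1 w) (D / 2)) => /= [_|DZ]; last first.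
      by rewrite (le_lt_trans rD DZ) add0r lerDl.
    case: (boolP (far i)) => [_|]; first by rewrite -addrA lerDl addr_ge0.
    rewrite negb_forall => /existsP[x]; rewrite -leNgt => hxD.
    by rewrite add0r ler_wpDl // (bigD1 x) //= hxD lerDl sumr_ge0.
  rewrite !big_split /= exchange_big /=.
  have : \sum_(x : 'I_(pK th)) \sum_(i < n.+1)
      ((`|(pT xs).[i.+1%:R] - (pT x).[i.+1%:R]| <= D)%R)%:R <= c / 4 * n.+1%:R :> R.
    apply: le_trans (_ : \sum_(x : 'I_(pK th)) dl * n.+1%:R <= _).
      by apply: ler_sum.
    rewrite sumr_const card_ord -[_ *+ _]mulr_natl mulrA ler_wpM2r //.
    have -> : c / 4 = K%:R * dl by rewrite /dl; field; rewrite gt_eqF.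
    by rewrite ler_wpM2r ?ler_nat // ltW.
  have := hn1 xs; lra.
have vsum : \sum_(i < n.+1) log_cost m 1 (Zmax Z i.+1 w) <= (k%:R + 1) * n.+1%:R.
  apply: le_trans (_ : \sum_(i < n.+1) (k%:R +
     Num.max 0 (log_cost m 1 (Zmax Z i.+1 w) - k%:R)) <= _).
    apply: ler_sum => i _; rewrite -lerBlDl le_max lexx orbT //.
  by rewrite big_split /= sumr_const card_ord -[_ *+ _]mulr_natr mulrDl lerD.
have gs : (\sum_(i < n.+1) (good i)%:R) * (ln (g (D / 2)) - ln G) <=
    - (B * n.+1%:R).
  apply: le_trans (_ : (c / 2 * n.+1%:R) * - tau <= _).
    apply: le_trans (_ : (c / 2 * n.+1%:R) * (ln (g (D / 2)) - ln G) <= _).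
      by rewrite ler_wnM2r // (le_trans eG) // oppr_le0.
    by rewrite ler_wpM2l // mulr_ge0 // divr_ge0 // ltW.
  by rewrite /tau mulrN lerN2 le_eqVlt; apply/orP; left; apply/eqP; field; rewrite gt_eqF.
have nB : n.+1%:R * (ln G - ln s + k%:R + 1 + 1) <= B * n.+1%:R.
  by rewrite mulrC ler_wpM2r // ler_norm.
have nE : n.+1%:R = n%:R + 1 :> R by rewrite natr1.
have : ln (ppi (X 1%N w)) + n%:R * ln s - (k%:R + 1) * n.+1%:R <=
   n.+1%:R * ln G - B * n.+1%:R by lra.
move: hn5 nB; rewrite nE; lra.
Unshelve. all: by end_near.
Qed.

Lemma no_spurious_state (M1 : R) : 0 < M1 ->
  {ae P, forall w, exists n0 : nat, forall n : nat, (n0 <= n)%N ->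
    forall xs : 'I_(pK ts), exists x : 'I_(pK (thhat n w)),
      sup_close n M1 (pT xs) (pT x)} ->
  exists2 M : R, M1 <= M &
  {ae P, forall w, exists n0 : nat, forall n : nat, (n0 <= n)%N ->
    forall x : 'I_(pK (thhat n w)), exists xs : 'I_(pK ts),
      sup_close n M (pT xs) (pT x)}.
Proof.
move=> M10 hcov.
have tsK : (pK ts <= K)%N by have [/andP[]] := hts.
have K0 : 0 < K%:R :> R.
  by rewrite ltr0n; have [/andP[h1 h2] _ _ _ _] := hts; exact: leq_trans h2.
have [mni _] := mmin.
set G := g 0; have G0 : 0 < G by exact: g_gt0.
pose A := ((s * (1 - s)) ^+ 2)^-1.
have A0 : 0 < A by rewrite invr_gt0 exprn_gt0 // mulr_gt0.
pose c0 := ln (1 + A * G).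
have c00 : 0 <= c0 by rewrite ln_ge0 // lerDl mulr_ge0 // ltW.
pose L := - ln (1 - s).
have L0 : 0 < L by rewrite oppr_gt0 ln_lt0 // s1 gtrBl s0.
(* Budget per observation, out of the gain [L]: [L / 8] for ordinary times, [L / 4] for exceptional
   ones (half from noise, half from trends), [4 * (L / 16)] for the excess cost. There remains
   [3 / 8 * L], to absorb [ln (K / (1 - s))]. *)
have [k c0k hk] := log_cost_tail s01 hpi hQ hg hdata (Num.bound c0) mni m_gt0
  (ltW M10) (divr_gt0 L0 (ltr0n R 16)) (mint M10).
have {}c0k : c0 < k%:R.
  by apply: lt_le_trans (archi_boundP c00) _; rewrite ler_nat.
pose a : R := 2 * k%:R.
have ca0 : 0 < c0 + a by rewrite /a; lra.
have [r0 r00 hr0] := noise_tail_count s01 hpi hQ hg hdata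
  (divr_gt0 L0 (mulr_gt0 (ltr0n R 8) ca0)).
have Aa0 : 0 < 8 * (A * expR a) by rewrite !mulr_gt0 // expR_gt0.
have [D D0 [rD gD]] := g_small r0 (divr_gt0 L0 Aa0).
set e := g (D / 2) in gD.
have De : 0 <= D / 2 by rewrite divr_ge0.
have e0 : 0 < e by exact: g_gt0.
have eG : e <= G by apply: gni.1.
pose dl := L / (8 * (c0 + a) * K%:R).
have dl0 : 0 < dl by rewrite divr_gt0 // !mulr_gt0.
pose M := Num.max M1 (D * (1 + 2 * (2 * d.+1%:R / dl)) ^+ d).
exists M; first by rewrite le_max lexx.
near=> w.
have [n1 hn1] : exists n0 : nat, forall n : nat, (n0 <= n)%N ->
    forall xs : 'I_(pK ts), exists x : 'I_(pK (thhat n w)),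
      sup_close n M1 (pT xs) (pT x) by near: w.
have [n2 hn2] : exists n0 : nat, forall n : nat, (n0 <= n)%N ->
   \sum_(i < n) Num.max 0 (log_cost m M1 (Zmax Z i.+1 w) - k%:R) <= L / 16 * n%:R by near: w.
have [n3 hn3] : exists n0 : nat, forall n : nat, (n0 <= n)%N ->
   \sum_(i < n) ((r0 < Zmax Z i.+1 w)%R)%:R <= L / (8 * (c0 + a)) * n%:R by near: w.
have [n4 hn4] := eventually_natr_gt (d.+1%:R / dl).
have [n5 hn5] := eventually_natr_gt (8 / (3 * L) * ln (K%:R / (1 - s))).
exists (maxn (maxn n1 n2) (maxn n3 (maxn n4 (maxn n5 1)))) => n.
rewrite !geq_max => /andP[/andP[/hn1 {}hn1 /hn2 {}hn2] /andP[/hn3 {}hn3]].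
move=> /andP[/hn4 {}hn4 /andP[/hn5 {}hn5 n0]] x0.
apply: contrapT => /forallNP nclose.
case: n n0 hn1 hn2 hn3 hn4 hn5 x0 nclose => // n _ hn1 hn2 hn3 hn4 hn5 x0 nclose.
have [thT _] := hmax n.+1 w.
have hmx := @loglik_max n w.
have femis := fun (a : 'I_(pK (thhat n.+1 w))) i => @far_emission _ a w i D.
(* The estimator is opened so that its number of states becomes a literal successor, as deletion
   requires. *)
case: (thhat n.+1 w) hn1 x0 nclose thT hmx femis => K' mu Q gam T /=.
case: K' mu Q gam T => [|k'] mu Q gam T hn1 x0 nclose thT hmx femis; first by have := ltn_ord x0.
have [/= k'K _ _ thg thd] := thT.
(* Coverage supplies a fitted state near the current true trend; it is not [x0], which is farther
   than [M >= M1] from every true trend. *)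
have hc i : exists j : 'I_k', sup_close n.+1 M1 (pT (X i.+1 w)) (T (lift x0 j)).
  have [x hx] := hn1 (X i.+1 w).
  case: (unliftP x0 x) hx => [j ->|->] hx; first by exists j.
  case: (nclose (X i.+1 w)) => y yn; apply: le_trans (hx y yn) _.
  by rewrite /M le_max lexx.
have [c hc'] := choice hc.
pose far i := [exists xs : 'I_(pK ts), `|(pT xs).[i.+1%:R] - (T x0).[i.+1%:R]| <= D].
pose exc i := (D / 2 < Zmax Z i.+1 w) || far i.
pose V i := log_cost m M1 (Zmax Z i.+1 w).
pose th := Param mu Q gam T.
pose Y := obs X Z w.
have em0 i (j : 'I_k'.+1) : 0 < @emission R th Y i j by apply: gam_gt0; exact: thg.
pose rho i := if (i < n.+1)%N then (if exc i then G else e) * expR (V i)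
  else @emission R th Y i x0 / @emission R th Y i (lift x0 (c i)).
have rho0 i : 0 <= rho i.
  rewrite /rho; case: ifP => _; last by rewrite divr_ge0 // ltW.
  by rewrite mulr_ge0 ?expR_ge0 //; case: ifP => _; exact: ltW.
have hrho i : @emission R th Y i x0 <= rho i * @emission R th Y i (lift x0 (c i)).
  rewrite /rho; case: ifP => [ltin|_]; last by rewrite divfK // gt_eqF.
  apply: le_trans (_ : (if exc i then G else e) <= _).
    case: ifP => [_|]; first exact: (@emission_le th).
    rewrite /exc /far => /negbT; rewrite negb_or -leNgt negb_exists => /andP[ZD /forallP nf].
    by apply: femis => //; rewrite ltNge.
  rewrite -mulrA -[leLHS]mulr1 ler_wpM2l //; first by case: ifP => _; exact: ltW.
  rewrite mulrC -ler_pdivrMr ?expR_gt0 // div1r -expRN.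
  apply: le_trans (expR_log_cost _) _.
    by rewrite m_gt0 // addr_ge0 ?(ltW M10) // Zmax_ge0.
  rewrite /emission /Y (obs_sub _ (erefl _)); apply: gam_ge; first exact: thg.
  rewrite (le_trans (ler_normD _ _)) // addrC lerD ?Zmax_ge //.
  by apply: hc'; rewrite ler0n ler_nat.
have [th' th'T] := loglik_delete_state n s01 thT gam_gt0 rho0 hrho.
have h1 : loglik th' Y n.+1 <= loglik th Y n.+1 := hmx th' th'T.
move=> h2.
have h3 : \sum_(i < n.+1) ln (1 + rho i / (s * (1 - s)) ^+ 2) <= 5 / 8 * L * n.+1%:R.
  apply: le_trans (_ : \sum_(i < n.+1) (A * e * expR a + (c0 + a) * (exc i)%:R +
      4 * Num.max 0 (V i - k%:R)) <= _).
    apply: ler_sum => i _; rewrite /rho ltn_ord mulrC.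
    by apply: ln_penalty_le; rewrite ?(ltW A0) ?(ltW e0) // ?log_cost_ge0 // /a -/c0; lra.
  rewrite !big_split /= sumr_const card_ord -!mulr_sumr -[_ *+ _]mulr_natr.
  have hx (xs : 'I_(pK ts)) : \sum_(i < n.+1)
      ((`|(pT xs).[i.+1%:R] - (T x0).[i.+1%:R]| <= D)%R)%:R <= dl * n.+1%:R :> R.
    apply: (@count_not_sup_close R d n.+1 _ _ D dl M) => //.
    - by have [_ _ _ _ h] := hts; exact: h.

    - by rewrite mulrC -ler_pdivrMr // ltW.
    by rewrite /M le_max lexx orbT.
  have excs : \sum_(i < n.+1) (exc i)%:R <= L / (8 * (c0 + a)) * n.+1%:R +
      L / (8 * (c0 + a)) * n.+1%:R.
    apply: le_trans (_ : \sum_(i < n.+1) (((r0 < Zmax Z i.+1 w)%R)%:R +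
        \sum_(xs : 'I_(pK ts)) ((`|(pT xs).[i.+1%:R] - (T x0).[i.+1%:R]| <= D)%R)%:R) <= _).
      apply: ler_sum => i _; rewrite /exc.
      have S0 : 0 <= \sum_(xs : 'I_(pK ts))
          ((`|(pT xs).[i.+1%:R] - (T x0).[i.+1%:R]| <= D)%R)%:R :> R by rewrite sumr_ge0.
      case: ltP => /= [DZ|_]; first by rewrite (le_lt_trans rD DZ) lerDl.
      case: (boolP (far i)) => [/existsP[xs hxs]|_]; last by rewrite addr_ge0.
      by rewrite ler_wpDl // (bigD1 xs) //= hxs lerDl sumr_ge0.
    rewrite big_split /= exchange_big /= lerD //.
    apply: le_trans (_ : \sum_(xs : 'I_(pK ts)) dl * n.+1%:R <= _).
      by apply: ler_sum.
    rewrite sumr_const card_ord -[_ *+ _]mulr_natl mulrA ler_wpM2r //.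
    have -> : L / (8 * (c0 + a)) = K%:R * dl by rewrite /dl; field; rewrite !gt_eqF.
    by rewrite ler_wpM2r ?ler_nat // ltW.
  have e1 : A * e * expR a * n.+1%:R <= L / 8 * n.+1%:R.
    rewrite ler_wpM2r // mulrAC -ler_pdivlMl ?mulr_gt0 ?expR_gt0 //.
    by apply: le_trans gD _; rewrite le_eqVlt; apply/orP; left; apply/eqP; field;
      rewrite !gt_eqF ?expR_gt0.
  have e2 : (c0 + a) * \sum_(i < n.+1) (exc i)%:R <= L / 4 * n.+1%:R.
    apply: le_trans (_ : (c0 + a) * (L / (8 * (c0 + a)) * n.+1%:R +
      L / (8 * (c0 + a)) * n.+1%:R) <= _); first by rewrite ler_wpM2l // ltW.
    by rewrite le_eqVlt; apply/orP; left; apply/eqP; field; rewrite gt_eqF.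
  have e3 : \sum_(i < n.+1) Num.max 0 (V i - k%:R) <= L / 16 * n.+1%:R by [].
  lra.
have h4 : ln (k'%:R / (1 - s)) <= ln (K%:R / (1 - s)).
  have k'0 : (0 < k')%N by exact: leq_ltn_trans (leq0n _) (ltn_ord (c 0%N)).
  rewrite ler_ln ?posrE ?divr_gt0 // ?ltr0n // ler_wpM2r ?invr_ge0 ?(ltW s1) //.
  by rewrite ler_nat ltnW.
have h5 : ln (K%:R / (1 - s)) < 3 / 8 * L * n.+1%:R.
  move: hn5; rewrite mulrC mulrA -ltr_pdivlMr; last first.
    by rewrite invr_gt0 mulr_gt0.
  rewrite invrK => h; lra.
have h6 : n.+1%:R * ln (1 - s) = - (L * n.+1%:R) by rewrite /L; ring.
move: h2; rewrite h6 => h2.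
lra.
Unshelve. all: by end_near.
Qed.

End localization.

Unset Implicit Arguments.

Theorem theorem4 (R : realType) (K d : nat) (sigm : R)
  (Gam : set {ptws R -> R})
  (d0 : measure_display) (Omega : measurableType d0) (P : probability Omega R)
  (ts : param R)
  (X : nat -> Omega -> 'I_(pK ts)) (Z : 'I_(pK ts) -> nat -> Omega -> R)
  (thhat : nat -> Omega -> param R) :
  (1 <= K)%N -> (1 <= d)%N -> 0 < sigm < 1 ->
  (forall gam, Gam gam -> is_density gam) ->
  compact Gam ->
  in_Theta K d sigm Gam ts ->
  data_model P X Z ->
  Amax Gam ->
  (exists m : R -> R, Amin Gam m /\
     forall M : R, 0 < M ->
       P.-integrable setT (fun w => (ln (m (M + Zmax Z 1 w)))%:E)) ->
  (forall n w, in_Theta K d sigm Gam (thhat n w) /\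
     forall th, in_Theta K d sigm Gam th ->
       (n%:R)^-1 * loglik th (obs X Z w) n <= (n%:R)^-1 * loglik (thhat n w) (obs X Z w) n) ->
  exists M : R, 0 < M /\
    {ae P, forall w, exists nloc : nat, forall n : nat, (nloc <= n)%N ->
       Theta_OK ts n M (thhat n w)}.
Proof.
move=> _ _ s01 hdens _ hts hdata [g [gni [gcv gub]]] [m [mmin mint]] hmax.
have [M1 M10 hcov] :=
  true_states_covered s01 hdens hts hdata gni gcv gub mmin mint hmax.
have [M M1M hspur] :=
  no_spurious_state s01 hdens hts hdata gni gcv gub mmin mint hmax M10 hcov.
exists M; split; first exact: lt_le_trans M10 M1M.
apply: filterS2 hcov hspur => w [n1 hn1] [n2 hn2].
exists (maxn n1 n2) => n; rewrite geq_max => /andP[/hn1 h1 /hn2 h2]; split => // xs.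
(* Coverage was obtained with the smaller radius [M1]. *)
by have [x hx] := h1 xs; exists x => y yn; apply: le_trans (hx y yn) M1M.
Qed.
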